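(* Let $P$ be a $\frac{13}{5}$-adaptable subset of $[0,1]^3$ of size $n$. For $\delta>0$ let $\#\mathcal{V}_\delta(P)$ denote the number of distinct $\delta$-separated volumes determined by $P$. Then $$\#\mathcal{V}_{n^{-5/13}}(P) \gtrapprox n^{5/13}.$$ That is, for every $C>0$ and every $\epsilon>0$ there exists $C_\epsilon>0$ (depending only on $C$ and $\epsilon$) such that for every $n$ and every $P \subset [0,1]^3$ with $n$ elements that is $\frac{13}{5}$-adaptable with constant $C$, one has $n^{5/13} \le C_\epsilon\, n^{\epsilon}\, \#\mathcal{V}_{n^{-5/13}}(P)$.
   Context: For a set $P$ of $n$ points in $[0,1]^d$ and $s>0$, define the measure $d\mu_P^s(x) = n^{-1}\cdot n^{d/s} \sum_{p\in P} \chi_{B^p_{n^{-1/s}}}(x)\, dx$, where $\chi_{B^p_{n^{-1/s}}}$ is the characteristic function of the ball of radius $n^{-1/s}$ centered at $p$. $P$ is called $s$-adaptable if $I_s(\mu_P) = \int\int |x-y|^{-s}\, d\mu_P^s(x)\, d\mu_P^s(y) < \infty$, understood as a bound uniform in $n$: $P$ is $s$-adaptable with constant $C$ if $I_s(\mu_P) \le C$, with $C$ independent of $n$. Here $d=3$ and $s=\frac{13}{5}$. The volumes determined by $P\subset\mathbb{R}^3$ are the elements of $\mathcal{V}(P) = \{\det(x^1,x^2,x^3) : x^1,x^2,x^3\in P\}$, where $\det(x^1,x^2,x^3)$ is the determinant of the matrix whose $j$th column is $x^j$; $\#\mathcal{V}_\delta(P)$ is the maximal cardinality of a subset of $\mathcal{V}(P)$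 whose distinct elements are pairwise at distance at least $\delta$. *)

(* Defs.v *)
From HB Require Import structures.
From mathcomp Require Import all_boot all_order all_algebra.
From mathcomp Require Import finmap.
From mathcomp Require Import all_classical all_reals all_analysis.
From mathcomp Require Import measurable_realfun.

Set Implicit Arguments.
Unset Strict Implicit.
Unset Printing Implicit Defensive.

Import Order.TTheory GRing.Theory Num.Theory.
Import numFieldNormedType.Exports.

Local Open Scope classical_set_scope.
Local Open Scope ring_scope.
Local Open Scope fset_scope.

(* R^3, with the Borel sigma-algebra that the library puts on products. *)
Notation R3 R :=
  (measurableTypeR R * measurableTypeR R * measurableTypeR R)%type.

Definition coord {R : realType} (x : R3 R) (i : 'I_3) : R :=
  [:: x.1.1 : R; x.1.2 : R; x.2 : R]`_i.

(* The library's norm on a product is the sup norm, hence this definition. *)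
Definition edist {R : realType} (x y : R3 R) : R :=
  Num.sqrt (\sum_(i < 3) (coord x i - coord y i) ^+ 2).

Definition eball {R : realType} (p : R3 R) (r : R) : set (R3 R) :=
  [set x | edist p x <= r].

Definition unit_cube {R : realType} : set (R3 R) :=
  [set x | forall i : 'I_3, 0 <= coord x i <= 1].

Definition lebesgue3 {R : realType} : set (R3 R) -> \bar R :=
  (@lebesgue_measure R \x @lebesgue_measure R \x @lebesgue_measure R)%E.

HB.instance Definition _ (R : realType) := Measure.on (@lebesgue3 R).

(* The density of mu_P^s with respect to Lebesgue measure on R^3. *)
Definition mu_density {R : realType} (s : R) (P : {fset R3 R}) (x : R3 R) : R :=
  (#|` P |%:R)^-1 * (#|` P |%:R `^ (3 / s)) *
  \sum_(p <- P) \1_(eball p (#|` P |%:R `^ (- s^-1))) x.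

Definition mu {R : realType} (s : R) (P : {fset R3 R}) (A : set (R3 R)) :
    \bar R :=
  (\int[@lebesgue3 R]_(x in A) (mu_density s P x)%:E)%E.

Section mu_measure.
Context (R : realType) (s : R) (P : {fset R3 R}).

Lemma measurable_coord (i : 'I_3) :
  measurable_fun [set: R3 R] (fun x : R3 R => coord x i).
Proof.
case: i => -[|[|[|//]]] ?; rewrite /coord /=.
- exact: measurableT_comp measurable_fst measurable_fst.
- exact: measurableT_comp measurable_snd measurable_fst.
- exact: measurable_snd.
Qed.

Lemma measurable_edist (p : R3 R) : measurable_fun [set: R3 R] (edist p).
Proof.
apply: (measurableT_comp (f := @Num.sqrt R)).
  apply: continuous_measurable_fun; exact: sqrt_continuous.
apply: measurable_sum => i; apply: measurable_funX.
by apply: measurable_funB; [exact: measurable_cst|exact: measurable_coord].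
Qed.

Lemma measurable_eball (p : R3 R) r : measurable (eball p r).
Proof.
have := measurable_edist p measurableT
  (measurable_itv `]-oo, r] : measurable (_ : set (measurableTypeR R))).
by rewrite setTI; congr measurable; apply/seteqP; split=> x /=; rewrite in_itv.
Qed.

Lemma mu_density_ge0 x : 0 <= mu_density s P x.
Proof.
rewrite !mulr_ge0 ?invr_ge0 ?powR_ge0//.
by rewrite sumr_ge0// => p _; rewrite indicE.
Qed.

Lemma measurable_mu_density :
  measurable_fun [set: R3 R] (mu_density s P).
Proof.
apply: measurable_funM; first exact: measurable_cst.
apply: measurable_sum => p; apply: measurable_indic.
exact: measurable_eball.
Qed.

Let mu0 : mu s P set0 = 0%E.
Proof. exact: integral_set0. Qed.

Let mu_ge0 A : (0 <= mu s P A)%E.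
Proof. by apply: integral_ge0 => x _; rewrite lee_fin mu_density_ge0. Qed.

Let mu_sigma_additive : semi_sigma_additive (mu s P).
Proof.
move=> /= F mF tF mUF; rewrite /mu; apply: cvg_toP.
  apply: ereal_nondecreasing_is_cvgn => m n mn.
  apply: lee_sum_nneg_natr => // k _ _; apply: integral_ge0 => /= x Fkx.
  by rewrite lee_fin mu_density_ge0.
rewrite ge0_integral_bigcup//=.
- apply/measurable_funTS/measurableT_comp => //.
  exact: measurable_mu_density.
- by move=> x _; rewrite lee_fin mu_density_ge0.
Qed.

HB.instance Definition _ := isMeasure.Build _ _ _ (mu s P)
  mu0 mu_ge0 mu_sigma_additive.

End mu_measure.

(* The inverse is taken in \bar R, so that |x - y|^(-s) = +oo when x = y. *)
Definition energy {R : realType} (s : R) (nu : set (R3 R) -> \bar R) : \bar R :=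
  (\int[nu]_x \int[nu]_y ((edist x y `^ s)%:E)^-1)%E.

Definition adaptable {R : realType} (s C : R) (P : {fset R3 R}) : Prop :=
  (energy s (mu s P) <= C%:E)%E.

Definition volume {R : realType} (x1 x2 x3 : R3 R) : R :=
  \det (\matrix_(i < 3, j < 3) coord [:: x1; x2; x3]`_j i).

Definition volumes {R : realType} (P : {fset R3 R}) : {fset R} :=
  [fset volume x.1.1 x.1.2 x.2 | x in P `*` P `*` P].

Definition separated {R : realType} (delta : R) (S : {fset R}) : Prop :=
  forall a b, a \in S -> b \in S -> a != b -> delta <= `|a - b|.

Definition num_separated {R : realType} (delta : R) (V : {fset R}) : nat :=
  \max_(S <- fpowerset V | `[< separated delta S >]) #|` S |.

(* Main.v *)
Require Import Defs.
From mathcomp Require Import all_boot all_order all_algebra.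
From mathcomp Require Import finmap.
From mathcomp Require Import all_classical all_reals all_analysis.
From mathcomp Require Import measurable_realfun.
From mathcomp Require Import zify ring lra.
Import Order.TTheory GRing.Theory Num.Theory.
Import numFieldNormedType.Exports.
Import Defs.
Local Open Scope ring_scope.

Set Implicit Arguments.
Unset Strict Implicit.
Unset Printing Implicit Defensive.

(** For two points p, q of P the volumes det (p, q, z), z in P, are the values
    of the linear functional z |-> (p x q) . z.  Put delta = n^(-5/13).  If for
    some p, q only O(n^2 delta) pairs (z, z'), taken from a set of at least
    n / 2 points, satisfy |(p x q) . (z - z')| <= 2 delta, then Cauchy-Schwarz
    over the cells of a maximal delta-separated set of values leaves at least
    c / delta values ([num_separated_ge]).  The proof finds such a pair by
    averaging over p and q.

    Geometry.  A ball of radius delta contains a cube of side delta, so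
    adaptability bounds sum_(p, q) (|p - q| + 2 delta)^(-13/5) by C n^2
    ([energy_ge]).  By Markov's inequality at least half of the points have a
    potential of size O(n).  In the set A of these points a cluster of
    diameter rho >= delta has O(n rho^(13/5)) elements ([regular_frostman]);
    cutting into slices along one or two coordinates, a tube of width r has
    O(n r^(8/5)) and a slab O(n r^(3/5)).  If p x q lies in a ball of radius r
    whose centre is bounded away from 0, then p lies in a slab orthogonal to
    that centre and, for given p, q lies in a tube along p.  Hence only
    O(n^2 r^(11/5)) cross products lie in the ball ([cross_count]), while
    [degenerate_pairs_count] shows that for most pairs of points of A the
    cross product is bounded below.

    Fourier analysis.  Let S(xi) be the exponential sum over A with frequency
    xi.  A Fejer kernel with M ~ 1 / (5 delta) terms dominates the condition
    |(p x q) . (z - z')| <= 2 delta, so the number of coincidences, summed over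
    the good pairs (p, q), is O(M^(-2)) times the sum over j, k < M of
    sum_(p, q) |S((j - k) (p x q))|^2.  For j - k = t >= 1 the inner sum is
    O(n^4 t^(-6/5)) ([spectral_decay]).  Indeed A lies in a unit cube, so |S|^2
    is controlled by its averages over cubes of frequencies of side about 1,
    up to bounded weights on A ([sqsum_local_constancy]); such a cube receives
    O(n^2 t^(-11/5)) of the points t (p x q); and the integral of |S|^2 over a
    box of side about t is, again by a Fejer kernel, at most
    O(t^3) sum_(z, z') (t |z - z'|)^(-2) = O(t n^2).  The exponent
    -11/5 + 1 = -6/5 is summable, which gives O(n^4 delta) coincidences in
    total ([coincidences_sum]).

    All frequencies are kept on a lattice (1/N) Z^3 with N >= 1 / delta, to
    which the cross products are rounded, so that every integral over
    frequencies is a finite sum. *)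

(** * Elementary bounds on sine and cosine *)

Section trigonometric_bounds.
Variable R : realType.
Implicit Types x t : R.

Lemma sin_mvt x : 0 <= x -> exists2 y, 0 <= y <= x & sin x = cos y * x.
Proof.
move=> x0.
have csin : ({within `[0, x], continuous (@sin R)})%classic.
  by apply: continuous_subspaceT => y; exact: continuous_sin.
have [y] := MVT_segment x0 (fun y _ => is_derive_sin y) csin.
by rewrite in_itv/= sin0 !subr0 => yx ->; exists y.
Qed.

Lemma abs_sin_le x : `|sin x| <= `|x|.
Proof.
wlog x0 : x / 0 <= x.
  move=> H; case: (leP 0 x) => [|/ltW x0]; first exact: H.
  by rewrite -normrN -sinN -(normrN x); apply: H; rewrite oppr_ge0.
have [y _ ->] := sin_mvt x0.
by rewrite normrM ler_piMl// cos_max.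
Qed.

Lemma cos_ge_half x : `|x| <= 1 -> 2^-1 <= cos x.
Proof.
move=> x1; have -> : x = (x / 2) *+ 2 by rewrite -mulr_natr divfK.
rewrite cos_mulr2n cos2sin2.
have : sin (x / 2) ^+ 2 <= (2^-1) ^+ 2.
  rewrite -real_normK ?num_real// ler_sqr ?nnegrE// (le_trans (abs_sin_le _))//.
  by rewrite normrM [X in _ * X]ger0_norm//; lra.
rewrite (_ : 2^-1 ^+ 2 = 4^-1 :> R); last by field.
by lra.
Qed.

Lemma sin_ge_half x : 0 <= x <= 1 -> x / 2 <= sin x.
Proof.
move=> /andP[x0 x1]; have [y /andP[y0 yx] ->] := sin_mvt x0.
by rewrite mulrC ler_wpM2r// cos_ge_half// ger0_norm// (le_trans yx).
Qed.

End trigonometric_bounds.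

(** * The Fejer kernel *)

Section fejer_kernel.
Variable R : realType.
Implicit Types (f g : R -> R) (t : R) (J L : nat).

(** The sum over all differences j - k with j, k < J: each value m occurs
    J - |m| times, so this is a sum against the Fejer weights. *)
Definition dsum J f : R := \sum_(j < J) \sum_(k < J) f (j%:R - k%:R).

Definition csum L f : R := \sum_(i < L.*2.+1) f (i%:R - L%:R).

Lemma le_dsum J f g : (forall x, f x <= g x) -> dsum J f <= dsum J g.
Proof. by move=> fg; apply: ler_sum => j _; apply: ler_sum. Qed.

Lemma dsumZl J c f : dsum J (fun x => c * f x) = c * dsum J f.
Proof.
by rewrite /dsum mulr_sumr; apply: eq_bigr => j _; rewrite mulr_sumr.
Qed.

Lemma dsum_sum J (I : finType) (P : pred I) (f : I -> R -> R) :
  dsum J (fun x => \sum_(i | P i) f i x) = \sum_(i | P i) dsum J (f i).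
Proof.
rewrite /dsum exchange_big/=; under eq_bigr do rewrite exchange_big/=.
rewrite exchange_big/=; apply: eq_bigr => i _.
by rewrite exchange_big.
Qed.

Lemma csumZl L c f : csum L (fun x => c * f x) = c * csum L f.
Proof. by rewrite /csum mulr_sumr. Qed.

Lemma csum_ge0 L f : (forall x, 0 <= f x) -> 0 <= csum L f.
Proof. by move=> f0; apply: sumr_ge0. Qed.

(** Every m in [-L, L] is a difference j - k with k in [L, 2L) and j <= 3L, in
    L ways; Fejer weights thus dominate the indicator of a centred interval. *)
Lemma csum_le_dsum L f : (forall x, 0 <= f x) ->
  L%:R * csum L f <= dsum (3 * L).+1 f.
Proof.
move=> f0; pose J := (3 * L).+1.
have -> : dsum J f = \sum_(0 <= k < J) \sum_(0 <= j < J) f (j%:R - k%:R).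
  rewrite /dsum exchange_big/= big_mkord; apply: eq_bigr => k _.
  by rewrite big_mkord.
have LJ : (L <= L.*2 <= J)%N by rewrite /J -addnn; apply/andP; split; lia.
have /andP[LJ1 LJ2] := LJ.
rewrite (big_cat_nat (leq0n L) (leq_trans LJ1 LJ2))/=.
rewrite (big_cat_nat LJ1 LJ2)/=.
have s0 m n : 0 <= \sum_(m <= k < n) \sum_(0 <= j < J) f (j%:R - k%:R).
  by apply: sumr_ge0 => k _; apply: sumr_ge0.
apply: (@le_trans _ _ (\sum_(L <= k < L.*2) \sum_(0 <= j < J) f (j%:R - k%:R)));
  last by have := s0 0%N L; have := s0 L.*2 J; lra.
rewrite mulr_natl.
have -> : csum L f *+ L = \sum_(L <= k < L.*2) csum L f.
  by rewrite sumr_const_nat -addnn addnK.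
rewrite !big_nat; apply: ler_sum => k /andP[Lk kL].
have h1 : (k - L <= k - L + L.*2.+1)%N by rewrite leq_addr.
have h2 : (k - L + L.*2.+1 <= J)%N.
  by move: kL; rewrite /J -addnn; lia.
rewrite (big_cat_nat (leq0n _) (leq_trans h1 h2))/=.
rewrite (big_cat_nat h1 h2)/=.
have s1 m n : 0 <= \sum_(m <= j < n) f (j%:R - k%:R) by apply: sumr_ge0.
apply: (@le_trans _ _ (\sum_(k - L <= j < k - L + L.*2.+1) f (j%:R - k%:R)));
  last by have := s1 0%N (k - L)%N; have := s1 (k - L + L.*2.+1)%N J; lra.
rewrite -{1}[(k - L)%N]add0n big_addn addKn big_mkord /csum.
apply: ler_sum => i _; rewrite natrD natrB//.
by rewrite (_ : i%:R + (k%:R - L%:R) - k%:R = i%:R - L%:R)//; ring.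
Qed.

Lemma csum3_le_dsum3 L (F : R -> R -> R -> R) : (forall x y z, 0 <= F x y z) ->
  L%:R ^+ 3 * csum L (fun x => csum L (fun y => csum L (F x y))) <=
  dsum (3 * L).+1 (fun x => dsum (3 * L).+1 (fun y => dsum (3 * L).+1 (F x y))).
Proof.
move=> F0.
have -> : L%:R ^+ 3 * csum L (fun x => csum L (fun y => csum L (F x y))) =
    L%:R * csum L (fun x => L%:R * csum L (fun y => L%:R * csum L (F x y))).
  have -> : (fun x => L%:R * csum L (fun y => L%:R * csum L (F x y))) =
      fun x => L%:R ^+ 2 * csum L (fun y => csum L (F x y)).
    by apply: funext => x; rewrite csumZl; ring.
  by rewrite csumZl; ring.
apply: le_trans (csum_le_dsum _ _) _.
  move=> x; apply: mulr_ge0 => //; apply: csum_ge0 => y.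
  by apply: mulr_ge0 => //; apply: csum_ge0.
apply: le_dsum => x; apply: le_trans (csum_le_dsum _ _) _.
  by move=> y; apply: mulr_ge0 => //; apply: csum_ge0.
by apply: le_dsum => y; exact: csum_le_dsum.
Qed.

Definition fejer J t : R :=
  (\sum_(j < J) cos (j%:R * t)) ^+ 2 + (\sum_(j < J) sin (j%:R * t)) ^+ 2.

(** The sine parts cancel, since the set of differences is symmetric.  This
    splits a sum of cosines over a product of intervals into a product of
    one-dimensional Fejer kernels, one coordinate after another. *)
Lemma dsum_cos J a t :
  dsum J (fun m => cos (a + m * t)) = cos a * fejer J t.
Proof.
have -> : dsum J (fun m => cos (a + m * t)) =
  \sum_(j < J) \sum_(k < J)
    (cos a * (cos (j%:R * t) * cos (k%:R * t) + sin (j%:R * t) * sin (k%:R * t))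
    - sin a * (sin (j%:R * t) * cos (k%:R * t) - cos (j%:R * t) * sin (k%:R * t))).
  apply: eq_bigr => j _; apply: eq_bigr => k _.
  by rewrite cosD mulrBl cosB sinB.
under eq_bigr do rewrite sumrB -!mulr_sumr big_split/= sumrB.
rewrite sumrB -!mulr_sumr big_split/= sumrB.
have E (f g : 'I_J -> R) :
    \sum_i \sum_j (f i * g j) = (\sum_i f i) * (\sum_i g i).
  by rewrite big_distrlr.
by rewrite !E /fejer; ring.
Qed.

Lemma fejer_ge0 J t : 0 <= fejer J t.
Proof. by rewrite addr_ge0// sqr_ge0. Qed.

Lemma fejer_le J t : fejer J t <= J%:R ^+ 2.
Proof.
have := dsum_cos J 0 t; rewrite cos0 mul1r => <-.
rewrite /dsum (@le_trans _ _ (\sum_(j < J) \sum_(k < J) 1))//.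
  by apply: ler_sum => j _; apply: ler_sum => k _; exact: cos_le1.
under eq_bigr do rewrite sumr_const card_ord.
by rewrite sumr_const card_ord expr2 mulr_natr.
Qed.

Lemma fejerN J t : fejer J (- t) = fejer J t.
Proof.
have eC : \sum_(j < J) cos (j%:R * - t) = \sum_(j < J) cos (j%:R * t).
  by apply: eq_bigr => j _; rewrite mulrN cosN.
have eS : \sum_(j < J) sin (j%:R * - t) = - \sum_(j < J) sin (j%:R * t).
  by rewrite -sumrN; apply: eq_bigr => j _; rewrite mulrN sinN.
by rewrite /fejer eC eS sqrrN.
Qed.

(** Multiplication by 2 sin (t / 2) makes both Dirichlet sums telescope. *)
Lemma dirichlet_cos J t :
  2 * sin (t / 2) * (\sum_(j < J) cos (j%:R * t)) =
  sin ((J%:R - 2^-1) * t) + sin (t / 2).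
Proof.
elim: J => [|J IH].
  by rewrite big_ord0 mulr0 sub0r mulNr (mulrC _ t) sinN addNr.
rewrite big_ord_recr/= mulrDr IH -[J.+1%:R]natr1.
have -> : (J%:R + 1 - 2^-1) * t = J%:R * t + t / 2 :> R by field.
have -> : (J%:R - 2^-1) * t = J%:R * t - t / 2 :> R by field.
by rewrite sinB sinD; ring.
Qed.

Lemma dirichlet_sin J t :
  2 * sin (t / 2) * (\sum_(j < J) sin (j%:R * t)) =
  cos (t / 2) - cos ((J%:R - 2^-1) * t).
Proof.
elim: J => [|J IH].
  by rewrite big_ord0 mulr0 sub0r mulNr (mulrC _ t) cosN subrr.
rewrite big_ord_recr/= mulrDr IH -[J.+1%:R]natr1.
have -> : (J%:R + 1 - 2^-1) * t = J%:R * t + t / 2 :> R by field.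
have -> : (J%:R - 2^-1) * t = J%:R * t - t / 2 :> R by field.
by rewrite cosB cosD; ring.
Qed.

(** The range |t| <= 1 keeps sin (t / 2) comparable to t; points of the unit
    cube and frequency steps at most 1 never leave it. *)
Lemma fejer_decay J t : `|t| <= 1 -> t ^+ 2 * fejer J t <= 32.
Proof.
wlog t0 : t / 0 <= t.
  move=> H; case: (leP 0 t) => [|/ltW t0]; first exact: H.
  rewrite -normrN => t1.
  by rewrite -[t ^+ 2]sqrrN -fejerN; apply: H => //; rewrite oppr_ge0.
rewrite ger0_norm// => t1.
have s4 : t / 4 <= sin (t / 2).
  by apply: le_trans (sin_ge_half _); lra.
have := dirichlet_cos J t; have := dirichlet_sin J t.
rewrite /fejer; set C := \sum_(_ < _) cos _; set S := \sum_(_ < _) sin _.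
move=> eS eC.
have sq4 (x : R) : `|x| <= 2 -> x ^+ 2 <= 4.
  move=> x2; rewrite -real_normK ?num_real// (_ : 4 = 2 ^+ 2); last by ring.
  by rewrite ler_sqr// nnegrE.
have hC : (2 * sin (t / 2) * C) ^+ 2 <= 4.
  apply: sq4; rewrite eC (le_trans (ler_normD _ _))//.
  by have := sin_max ((J%:R - 2^-1) * t); have := sin_max (t / 2); lra.
have hS : (2 * sin (t / 2) * S) ^+ 2 <= 4.
  apply: sq4; rewrite eS (le_trans (ler_normB _ _))//.
  by have := cos_max ((J%:R - 2^-1) * t); have := cos_max (t / 2); lra.
have h1 : (2 * sin (t / 2)) ^+ 2 * (C ^+ 2 + S ^+ 2) <= 8.
  by rewrite mulrDr -!exprMn; lra.
have h2 : (t / 2) ^+ 2 <= (2 * sin (t / 2)) ^+ 2.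
  by rewrite ler_sqr ?nnegrE; lra.
have h3 := le_trans (ler_wpM2r (fejer_ge0 J t) h2) h1.
by move: h3; rewrite /fejer -/C -/S; lra.
Qed.

End fejer_kernel.

(** * Exponential sums and their local constancy *)

Section exponential_sums.
Variables (R : realType) (T : finType) (A : {set T}).
Implicit Types (w phi : T -> R).

(** Expand the sum of (f i - f j)^2 over all i, j. *)
Lemma sqr_sum_le (I : finType) (D : {set I}) (f : I -> R) :
  (\sum_(i in D) f i) ^+ 2 <= #|D|%:R * \sum_(i in D) f i ^+ 2.
Proof.
have : 0 <= \sum_(i in D) \sum_(j in D) (f i - f j) ^+ 2.
  by apply: sumr_ge0 => i _; apply: sumr_ge0 => j _; rewrite sqr_ge0.
have -> : \sum_(i in D) \sum_(j in D) (f i - f j) ^+ 2 =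
    2 * (#|D|%:R * \sum_(i in D) f i ^+ 2) - 2 * (\sum_(i in D) f i) ^+ 2.
  have -> : \sum_(i in D) \sum_(j in D) (f i - f j) ^+ 2 =
      \sum_(i in D) \sum_(j in D) (f i ^+ 2 + f j ^+ 2 - 2 * (f i * f j)).
    by apply: eq_bigr => i _; apply: eq_bigr => j _; ring.
  under eq_bigr do rewrite sumrB big_split/= sumr_const -mulr_sumr -mulr_sumr.
  rewrite sumrB big_split/= sumr_const -mulr_sumr -mulr_suml sumrMnl.
  by rewrite -[_ *+ #|D|]mulr_natl; ring.
lra.
Qed.

(** The squared modulus of sum_(p in A) w p exp (i phi p), in real terms. *)
Definition sqsum w phi : R :=
  (\sum_(p in A) w p * cos (phi p)) ^+ 2 +
  (\sum_(p in A) w p * sin (phi p)) ^+ 2.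

Lemma sqsum_ge0 w phi : 0 <= sqsum w phi.
Proof. by rewrite addr_ge0// sqr_ge0. Qed.

Lemma sqsumE w phi : sqsum w phi =
  \sum_(p in A) \sum_(q in A) w p * w q * cos (phi p - phi q).
Proof.
rewrite /sqsum !expr2 !big_distrlr/= -big_split/=; apply: eq_bigr => p _.
rewrite -big_split/=; apply: eq_bigr => q _.
by rewrite cosB; ring.
Qed.

(** The factor that undoes the averaging of exp (i phi p) over the shifts eta:
    by symmetry of the shifts, that averaging multiplies each term by the mean
    of cos (eta e p), which is at least 1/2 for shifts of size at most 1. *)
Definition smoothing_weight (H : finType) (eta : H -> T -> R) (p : T) : R :=
  #|H|%:R / \sum_e cos (eta e p).

Lemma smoothing_weight_bound (H : finType) (eta : H -> T -> R) p :
  (0 < #|H|)%N -> (forall e, `|eta e p| <= 1) ->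
  0 < \sum_e cos (eta e p) /\ 0 <= smoothing_weight eta p <= 2.
Proof.
move=> H0 eta1.
have D0 : #|H|%:R / 2 <= \sum_e cos (eta e p).
  rewrite mulrC mulr_natr -sumr_const; apply: ler_sum => e _.
  exact: cos_ge_half.
have H0' : 0 < #|H|%:R :> R by rewrite ltr0n.
have Dp : 0 < \sum_e cos (eta e p) by lra.
split=> //; apply/andP; split; first by rewrite divr_ge0 ?ltW.
by rewrite ler_pdivrMr//; lra.
Qed.

(** With the compensating weights, the exponential sum at phi is exactly the
    mean of the weighted sums at the shifted frequencies; Cauchy-Schwarz does
    the rest.  The involution s pairs opposite shifts. *)
Lemma sqsum_local_constancy (H : finType) (s : H -> H) (eta : H -> T -> R) phi :
  (0 < #|H|)%N -> involutive s -> (forall e p, eta (s e) p = - eta e p) ->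
  (forall e, {in A, forall p, `|eta e p| <= 1}) ->
  sqsum (fun=> 1) phi <=
  #|H|%:R^-1 * \sum_e sqsum (smoothing_weight eta) (fun p => phi p + eta e p).
Proof.
move=> H0 sK etas eta1; set w := smoothing_weight eta.
have H0' : 0 < #|H|%:R :> R by rewrite ltr0n.
have sin0 p : \sum_e sin (eta e p) = 0.
  have : \sum_e sin (eta e p) = - \sum_e sin (eta e p).
    rewrite {1}(reindex_inj (inv_inj sK))/= -sumrN.
    by apply: eq_bigr => e _; rewrite etas sinN.
  lra.
have sumcos p : \sum_e cos (phi p + eta e p) = cos (phi p) * \sum_e cos (eta e p).
  under eq_bigr do rewrite cosD.
  by rewrite sumrB -!mulr_sumr sin0 mulr0 subr0.
have sumsin p : \sum_e sin (phi p + eta e p) = sin (phi p) * \sum_e cos (eta e p).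
  under eq_bigr do rewrite sinD.
  by rewrite big_split/= -!mulr_sumr sin0 mulr0 addr0.
have key (f : R -> R) :
    (forall p, \sum_e f (phi p + eta e p) = f (phi p) * \sum_e cos (eta e p)) ->
    (\sum_(p in A) 1 * f (phi p)) ^+ 2 <=
    #|H|%:R^-1 * \sum_e (\sum_(p in A) w p * f (phi p + eta e p)) ^+ 2.
  move=> fE.
  have -> : \sum_(p in A) 1 * f (phi p) =
      #|H|%:R^-1 * \sum_e \sum_(p in A) w p * f (phi p + eta e p).
    rewrite exchange_big/= mulr_sumr; apply: eq_bigr => p pA.
    have [D0 _] := smoothing_weight_bound H0 (fun e => eta1 e p pA).
    rewrite -mulr_sumr fE /w /smoothing_weight; field.
    by rewrite !gt_eqF.
  rewrite exprMn expr2 -mulrA ler_wpM2l ?invr_ge0 ?ler0n//.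
  rewrite ler_pdivrMl//.
  have := sqr_sum_le [set: H] (fun e => \sum_(p in A) w p * f (phi p + eta e p)).
  by rewrite cardsT; under eq_bigl do rewrite inE;
     under [X in _ <= _ * X -> _]eq_bigl do rewrite inE.
rewrite {1}/sqsum (le_trans (lerD (key cos sumcos) (key sin sumsin)))//.
by rewrite -mulrDr -big_split.
Qed.

End exponential_sums.

(** * Counting frequencies in lattice boxes *)

Section lattice_boxes.
Variable R : realType.

Lemma csum3E L (F : R -> R -> R -> R) :
  csum L (fun x => csum L (fun y => csum L (F x y))) =
  \sum_(m : 'I_(L.*2.+1) * 'I_(L.*2.+1) * 'I_(L.*2.+1))
    F (m.1.1%:R - L%:R) (m.1.2%:R - L%:R) (m.2%:R - L%:R).
Proof. by rewrite /csum pair_bigA/= pair_bigA. Qed.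

(** A point of the large box is hit by (i, e) for at most one e for each i, and
    only by those i whose own small box contains it; B bounds their number. *)
Lemma sum_boxes_le (I : finType) (a W : nat) (k1 k2 k3 : I -> nat) (B : R)
    (F : 'I_W.+1 * 'I_W.+1 * 'I_W.+1 -> R) :
  (forall m, 0 <= F m) ->
  (forall i, [/\ k1 i + a <= W, k2 i + a <= W & k3 i + a <= W]%N) ->
  (forall m1 m2 m3 : nat, #|[set i | [&& k1 i <= m1 <= k1 i + a,
     k2 i <= m2 <= k2 i + a & k3 i <= m3 <= k3 i + a]%N]|%:R <= B) ->
  \sum_i \sum_(e : 'I_a.+1 * 'I_a.+1 * 'I_a.+1)
     F (inord (k1 i + e.1.1), inord (k2 i + e.1.2), inord (k3 i + e.2))
  <= B * \sum_m F m.
Proof.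
move=> F0 kW kB; rewrite pair_bigA/=.
pose phi (p : I * ('I_a.+1 * 'I_a.+1 * 'I_a.+1)) :
    'I_W.+1 * 'I_W.+1 * 'I_W.+1 :=
  (inord (k1 p.1 + p.2.1.1), inord (k2 p.1 + p.2.1.2), inord (k3 p.1 + p.2.2)).
rewrite (partition_big phi xpredT)//= mulr_sumr; apply: ler_sum => -[[m1 m2] m3] _.
pose S := [set p | phi p == (m1, m2, m3)].
rewrite (eq_bigl (fun p => p \in S)); last by move=> p; rewrite inE.
rewrite (eq_bigr (fun=> F (m1, m2, m3))); last first.
  by move=> p; rewrite inE => /eqP <-.
rewrite sumr_const -mulr_natl ler_wpM2r//.
apply: le_trans (kB m1 m2 m3); rewrite ler_nat.
have fstI : {in S &, injective fst}.
  move=> [i [[e1 e2] e3]] [i' [[f1 f2] f3]]; rewrite !inE.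
  move=> /eqP <- /eqP[+ + +] /= ei; rewrite -{}ei.
  have [w1 w2 w3] := kW i.
  have := ltn_ord e1; have := ltn_ord e2; have := ltn_ord e3.
  have := ltn_ord f1; have := ltn_ord f2; have := ltn_ord f3.
  move=> lf3 lf2 lf1 le3 le2 le1.
  move=> /(congr1 val) + /(congr1 val) + /(congr1 val).
  rewrite /= !inordK; try lia.
  by move=> h1 h2 h3; congr (_, (_, _, _)); apply: val_inj => /=; lia.
rewrite -(card_in_imset fstI); apply: subset_leq_card.
apply/fintype.subsetP => i /imsetP[[i' [[e1 e2] e3]]].
move=> + ->; rewrite !inE => /eqP[<- <- <-] /=.
have [w1 w2 w3] := kW i'.
have := ltn_ord e1; have := ltn_ord e2; have := ltn_ord e3.
move=> l3 l2 l1; rewrite !inordK; lia.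
Qed.

End lattice_boxes.

(** * Mean square of an exponential sum over given frequencies *)

Section spectral_bound.
Variables (R : realType) (T : finType) (A : {set T}) (pa pb pc : T -> R).

Definition phase (x y z : R) (p : T) : R := x * pa p + y * pb p + z * pc p.

Lemma phaseD x y z x' y' z' p :
  phase x y z p + phase x' y' z' p = phase (x + x') (y + y') (z + z') p.
Proof. by rewrite /phase; ring. Qed.

(** Expanding the square and summing one frequency coordinate at a time. *)
Lemma dsum3_sqsum J (h : R) (w : T -> R) :
  dsum J (fun x => dsum J (fun y => dsum J (fun z =>
    sqsum A w (phase (h * x) (h * y) (h * z))))) =
  \sum_(p in A) \sum_(q in A) w p * w q *
    (fejer J (h * (pa p - pa q)) * fejer J (h * (pb p - pb q)) *
     fejer J (h * (pc p - pc q))).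
Proof.
pose E (x y z : R) p q := w p * w q * cos (0 + x * (h * (pa p - pa q)) +
  y * (h * (pb p - pb q)) + z * (h * (pc p - pc q))).
have -> : dsum J (fun x => dsum J (fun y => dsum J (fun z =>
    sqsum A w (phase (h * x) (h * y) (h * z))))) =
  dsum J (fun x => dsum J (fun y => dsum J (fun z =>
    \sum_(p in A) \sum_(q in A) E x y z p q))).
  congr (dsum J); apply: funext => x; congr (dsum J); apply: funext => y.
  congr (dsum J); apply: funext => z; rewrite sqsumE.
  apply: eq_bigr => p _; apply: eq_bigr => q _; rewrite /E; congr (_ * cos _).
  by rewrite /phase; ring.
have D2 (G : R -> T -> T -> R) :
    dsum J (fun x => \sum_(p in A) \sum_(q in A) G x p q) =
    \sum_(p in A) \sum_(q in A) dsum J (fun x => G x p q).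
  by rewrite dsum_sum; apply: eq_bigr => p _; rewrite dsum_sum.
have -> : (fun x => dsum J (fun y => dsum J (fun z =>
      \sum_(p in A) \sum_(q in A) E x y z p q))) =
    fun x => \sum_(p in A) \sum_(q in A) dsum J (fun y => dsum J (fun z => E x y z p q)).
  apply: funext => x; rewrite -D2; congr (dsum J); apply: funext => y.
  by rewrite -D2.
rewrite D2; apply: eq_bigr => p _; apply: eq_bigr => q _.
set ta := h * (pa p - pa q); set tb := h * (pb p - pb q).
set tc := h * (pc p - pc q).
have -> : (fun x => dsum J (fun y => dsum J (fun z => E x y z p q))) =
    fun x => w p * w q * fejer J tc * fejer J tb * cos (0 + x * ta).
  apply: funext => x.
  have -> : (fun y => dsum J (fun z => E x y z p q)) =
      fun y => w p * w q * fejer J tc * cos (0 + x * ta + y * tb).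
    by apply: funext => y; rewrite /E dsumZl dsum_cos; ring.
  by rewrite dsumZl dsum_cos; ring.
by rewrite dsumZl dsum_cos cos0; ring.
Qed.

(** The large sieve for the frequencies h (k i + a - L): smooth over the cube of
    half-side a (local constancy), use that each lattice point is covered at
    most B times, and enlarge the box of frequencies to a product of Fejer
    weights, whose transform is the product of three Fejer kernels.  The
    factor 4 bounds the product of two compensating weights. *)
Lemma spectral_bound (I : finType) (k1 k2 k3 : I -> nat) (a L : nat) (h B : R) :
  (0 < L)%N -> 0 <= h -> h * a%:R * 3 <= 1 ->
  {in A, forall p, [/\ 0 <= pa p <= 1, 0 <= pb p <= 1 & 0 <= pc p <= 1]} ->
  (forall i, [/\ k1 i + a.*2 <= L.*2, k2 i + a.*2 <= L.*2 &
                 k3 i + a.*2 <= L.*2]%N) ->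
  (forall m1 m2 m3 : nat, #|[set i | [&& k1 i <= m1 <= k1 i + a.*2,
     k2 i <= m2 <= k2 i + a.*2 & k3 i <= m3 <= k3 i + a.*2]%N]|%:R <= B) ->
  a.*2.+1%:R ^+ 3 * L%:R ^+ 3 *
    \sum_i sqsum A (fun=> 1) (phase (h * (k1 i + a)%:R - h * L%:R)
      (h * (k2 i + a)%:R - h * L%:R) (h * (k3 i + a)%:R - h * L%:R)) <=
  4 * B * \sum_(p in A) \sum_(q in A) (fejer (3 * L).+1 (h * (pa p - pa q)) *
     fejer (3 * L).+1 (h * (pb p - pb q)) * fejer (3 * L).+1 (h * (pc p - pc q))).
Proof.
move=> L0 h0 ha A1 kL kB.
pose H := ('I_a.*2.+1 * 'I_a.*2.+1 * 'I_a.*2.+1)%type.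
pose s (e : H) : H := (rev_ord e.1.1, rev_ord e.1.2, rev_ord e.2).
have sK : involutive s by move=> [[e1 e2] e3]; rewrite /s/= !rev_ordK.
pose eta (e : H) := phase (h * (e.1.1%:R - a%:R)) (h * (e.1.2%:R - a%:R))
  (h * (e.2%:R - a%:R)).
have revE (e : 'I_a.*2.+1) : (rev_ord e)%:R - a%:R = - (e%:R - a%:R) :> R.
  rewrite /= subSS natrB; last by rewrite -ltnS ltn_ord.
  have -> : a.*2%:R = 2 * a%:R :> R by rewrite -mul2n natrM.
  by ring.
have etas e p : eta (s e) p = - eta e p.
  by rewrite /eta /s [(_, _, _).1.1]/= [(_, _, _).1.2]/= [(_, _, _).2]/= !revE
    /phase; ring.
have ha0 : 0 <= h * a%:R by rewrite mulr_ge0.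
have eta1 e : {in A, forall p, `|eta e p| <= 1}.
  move=> p pA; have [a1 b1 c1] := A1 p pA.
  have b (i : 'I_a.*2.+1) (x : R) : 0 <= x <= 1 ->
      `|h * (i%:R - a%:R) * x| <= h * a%:R.
    move=> /andP[x0 x1]; rewrite !normrM (ger0_norm h0) (ger0_norm x0).
    have : `|i%:R - a%:R : R| <= a%:R.
      have : i%:R <= 2 * a%:R :> R.
        by rewrite -natrM ler_nat mul2n -ltnS ltn_ord.
      have : 0 <= i%:R :> R by [].
      by rewrite ler_norml => i0 i2; apply/andP; split; lra.
    move=> /(ler_wpM2l h0) ha1.
    by rewrite (le_trans _ ha1)// ler_piMr// mulr_ge0.
  rewrite /eta /phase (le_trans (ler_normD _ _))//.
  have := ler_normD (h * (e.1.1%:R - a%:R) * pa p) (h * (e.1.2%:R - a%:R) * pb p).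
  have := b e.1.1 _ a1; have := b e.1.2 _ b1; have := b e.2 _ c1; lra.
have cardH : #|{: H}| = (a.*2.+1 ^ 3)%N.
  by rewrite !card_prod !card_ord !expnS expn0 muln1 mulnA.
have H0 : (0 < #|{: H}|)%N by rewrite cardH expn_gt0.
have H0' : 0 < #|{: H}|%:R :> R by rewrite ltr0n.
pose w := smoothing_weight eta.
have w2 p : p \in A -> 0 <= w p <= 2.
  by move=> pA; have [] := smoothing_weight_bound H0 (fun e => eta1 e p pA).
pose G x y z := sqsum A w (phase (h * x) (h * y) (h * z)).
have G0 x y z : 0 <= G x y z by exact: sqsum_ge0.
pose ff p q := fejer (3 * L).+1 (h * (pa p - pa q)) *
  fejer (3 * L).+1 (h * (pb p - pb q)) * fejer (3 * L).+1 (h * (pc p - pc q)).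
have ff0 p q : 0 <= ff p q by rewrite !mulr_ge0// fejer_ge0.
have step1 : a.*2.+1%:R ^+ 3 * \sum_i sqsum A (fun=> 1)
      (phase (h * (k1 i + a)%:R - h * L%:R)
      (h * (k2 i + a)%:R - h * L%:R) (h * (k3 i + a)%:R - h * L%:R)) <=
    B * csum L (fun x => csum L (fun y => csum L (G x y))).
  rewrite -natrX -cardH csum3E.
  apply: le_trans (@sum_boxes_le R I a.*2 L.*2 k1 k2 k3 B (fun m =>
    G (m.1.1%:R - L%:R) (m.1.2%:R - L%:R) (m.2%:R - L%:R)) _ kL kB).
    rewrite mulr_sumr; apply: ler_sum => i _.
    rewrite -ler_pdivlMl//.
    apply: le_trans (sqsum_local_constancy _ H0 sK etas eta1) _.
    rewrite ler_wpM2l ?invr_ge0 ?ler0n//; apply: ler_sum => e _.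
    rewrite -/w le_eqVlt; apply/orP; left; apply/eqP; congr sqsum.
    apply: funext => p; rewrite /eta phaseD.
    have [l1 l2 l3] := kL i.
    case: e => -[e1 e2] e3 /=.
    have := ltn_ord e1; have := ltn_ord e2; have := ltn_ord e3.
    move=> m3 m2 m1.
    rewrite !inordK; try lia.
    by rewrite !natrD; congr phase; ring.
  by move=> m; exact: G0.
have B0 : 0 <= B by exact: le_trans (kB 0%N 0%N 0%N).
have L3 : 0 <= L%:R ^+ 3 :> R by rewrite exprn_ge0.
have step2 : L%:R ^+ 3 * csum L (fun x => csum L (fun y => csum L (G x y))) <=
    4 * \sum_(p in A) \sum_(q in A) ff p q.
  apply: le_trans (csum3_le_dsum3 _ G0) _.
  rewrite /G dsum3_sqsum mulr_sumr; apply: ler_sum => p pA.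
  rewrite mulr_sumr; apply: ler_sum => q qA.
  have /andP[p0 p2] := w2 p pA; have /andP[q0 q2] := w2 q qA.
  rewrite -/(ff p q) ler_wpM2r// (_ : 4 = 2 * 2); last by ring.
  exact: ler_pM.
rewrite -[X in X <= _]mulrA mulrCA.
apply: le_trans (ler_wpM2l L3 step1) _.
rewrite mulrCA [4 * B]mulrC -[X in _ <= X]mulrA.
exact: ler_wpM2l.
Qed.

End spectral_bound.

(** * Clusters, tubes and slabs *)

Section counting.
Variables (R : realType) (T : finType).
Implicit Types (A D : {set T}) (Psi : R -> R) (f g fa fb fc : T -> R).

Lemma card_classes_le (J : finType) (g : T -> J) D (B : R) :
  (forall D', D' \subset D -> {in D' &, forall p q, g p = g q} ->
     #|D'|%:R <= B) ->
  #|D|%:R <= #|J|%:R * B.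
Proof.
move=> DB; rewrite -sum1_card (partition_big g xpredT)//= natr_sum.
rewrite mulr_natl -sumr_const; apply: ler_sum => j _.
rewrite sum1dep_card; apply: DB.
  by apply/fintype.subsetP => p; rewrite inE => /andP[].
by move=> p q; rewrite !inE => /andP[_ /eqP ->] /andP[_ /eqP ->].
Qed.

(** Cut the range [0, 1] of f into at most 1 / r + 1 <= 2 / r slices of width
    r. *)
Lemma slices_count f D (r B : R) : 0 < r <= 1 ->
  {in D, forall p, 0 <= f p <= 1} ->
  (forall D', D' \subset D -> {in D' &, forall p q, `|f p - f q| <= r} ->
     #|D'|%:R <= B) ->
  #|D|%:R <= 2 / r * B.
Proof.
move=> /andP[r0 r1] f01 DB.
have B0 : 0 <= B.
  have h := DB finset.set0 (finset.sub0set _); apply: (le_trans (ler0n _ _) (h _)) => p q.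
  by rewrite inE.
pose m := Num.truncn (r^-1).
have m1 : m.+1%:R <= 2 / r.
  have ri0 : 0 <= r^-1 by rewrite invr_ge0 ltW.
  have /andP[mr _] := truncn_itv ri0.
  rewrite -natr1; have : 1 <= r^-1 by rewrite invf_ge1.
  by move: mr; rewrite -/m; lra.
pose g p : 'I_m.+1 := inord (Num.truncn (f p / r)).
apply: le_trans (_ : m.+1%:R * B <= _); last exact: ler_wpM2r.
rewrite -{1}(card_ord m.+1); apply: (card_classes_le (g := g)) => D' D'D gD'.
apply: DB => // p q pD' qD'.
have fr (x : T) : x \in D' -> 0 <= f x / r <= r^-1.
  move=> xD'; have /andP[x0 x1] := f01 x (fintype.subsetP D'D x xD').
  by rewrite divr_ge0 ?(ltW r0)//= ler_pdivrMr// mulVf// gt_eqF.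
have fm (x : T) : x \in D' -> (Num.truncn (f x / r) < m.+1)%N.
  move=> /fr /andP[x0 xr]; rewrite ltnS le_truncn//.
have := congr1 val (gD' p q pD' qD'); rewrite /= !inordK ?fm// => epq.
have /andP[p0 _] := fr p pD'; have /andP[q0 _] := fr q qD'.
have /andP[lp up] := truncn_itv p0; have /andP[lq uq] := truncn_itv q0.
move: lp up; rewrite epq => lp up.
move: uq up; rewrite -natr1 => uq up.
have : `|f p / r - f q / r| <= 1 by rewrite ler_norml; apply/andP; split; lra.
rewrite -mulrBl normrM (gtr0_norm (_ : 0 < r^-1)) ?invr_gt0//.
by rewrite ler_pdivrMr// mul1r.
Qed.

Definition clustered fa fb fc (rho : R) D : Prop := {in D &, forall p q,
  [/\ `|fa p - fa q| <= rho, `|fb p - fb q| <= rho & `|fc p - fc q| <= rho]}.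

(** A dimension condition at scales above delta, for an arbitrary gauge Psi.
    Clusters are given by mutual closeness of coordinates, so that no centre
    has to be produced, and the condition is symmetric in the coordinates. *)
Definition frostman fa fb fc (delta : R) Psi A := forall rho D,
  delta <= rho -> D \subset A -> clustered fa fb fc rho D ->
  #|D|%:R <= Psi rho.

Lemma frostman_swap fa fb fc delta Psi A :
  frostman fa fb fc delta Psi A -> frostman fb fa fc delta Psi A.
Proof.
by move=> H rho D dr DA cD; apply: H dr DA _ => p q pD qD; case: (cD p q pD qD).
Qed.

Lemma frostman_rot fa fb fc delta Psi A :
  frostman fa fb fc delta Psi A -> frostman fc fa fb delta Psi A.
Proof.
by move=> H rho D dr DA cD; apply: H dr DA _ => p q pD qD; case: (cD p q pD qD).
Qed.

Definition in_unit A f : Prop := {in A, forall p, 0 <= f p <= 1}.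

(** The tube around the line spanned by (x1, x2, x3): within a slice of the
    first coordinate, where the direction is large, the other two coordinates
    are determined up to O(r / c). *)
Lemma tube_count fa fb fc delta Psi A D (x1 x2 x3 c r : R) :
  frostman fa fb fc delta Psi A -> in_unit A fa -> D \subset A ->
  0 < c <= 1 -> c <= `|x1| -> `|x2| <= 1 -> `|x3| <= 1 ->
  0 < r <= 1 -> delta <= r ->
  {in D &, forall p q,
    `|x1 * (fb p - fb q) - x2 * (fa p - fa q)| <= 2 * r /\
    `|x1 * (fc p - fc q) - x3 * (fa p - fa q)| <= 2 * r} ->
  #|D|%:R <= 2 / r * Psi (3 * r / c).
Proof.
move=> fro a01 DA /andP[c0 c1] cx1 x21 x31 r01 dr tube.
have /andP[r0 r1] := r01.
apply: (slices_count (f := fa)) => //.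
  by move=> p /(fintype.subsetP DA); exact: a01.
have r3 : r <= 3 * r / c by rewrite ler_pdivlMr//; nra.
move=> D' D'D cl; apply: fro; first exact: le_trans r3.
  exact: fintype.subset_trans DA.
have aux x (u v : R) : `|x| <= 1 -> `|u| <= r -> `|x1 * v - x * u| <= 2 * r ->
    `|v| <= 3 * r / c.
  move=> x1' ur /ler_normlP[h1 h2]; rewrite ler_pdivlMr// mulrC.
  apply: le_trans (_ : `|x1| * `|v| <= _); first exact: ler_wpM2r.
  rewrite -normrM.
  have : `|x * u| <= r by rewrite normrM -[leRHS]mul1r ler_pM.
  by move=> /ler_normlP[h3 h4]; apply/ler_normlP; split; lra.
move=> p q pD' qD'; have pqr := cl p q pD' qD'.
have [tb tc] := tube p q (fintype.subsetP D'D p pD') (fintype.subsetP D'D q qD').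
split; [exact: le_trans pqr r3|exact: aux tb|exact: aux tc].
Qed.

(** Within a slice of the second and third coordinates, the first one, where
    the normal vector is largest, is determined up to O(r / c). *)
Lemma slab_count fa fb fc delta Psi A D (u1 u2 u3 c r : R) :
  frostman fa fb fc delta Psi A -> in_unit A fb -> in_unit A fc ->
  D \subset A -> 0 < c <= 1 -> c <= `|u1| -> `|u2| <= `|u1| -> `|u3| <= `|u1| ->
  0 < r <= 1 -> delta <= r ->
  {in D, forall p, `|u1 * fa p + u2 * fb p + u3 * fc p| <= 3 * r} ->
  #|D|%:R <= 2 / r * (2 / r * Psi (8 * r / c)).
Proof.
move=> fro b01 c01 DA /andP[c0 c1] cu1 u21 u31 r01 dr slab.
have /andP[r0 r1] := r01.
apply: (slices_count (f := fb)) => //.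
  by move=> p /(fintype.subsetP DA); exact: b01.
move=> D1 D1D clb; apply: (slices_count (f := fc)) => //.
  by move=> p /(fintype.subsetP D1D) /(fintype.subsetP DA); exact: c01.
have r8 : r <= 8 * r / c by rewrite ler_pdivlMr//; nra.
move=> D2 D2D1 clc; apply: fro; first exact: le_trans r8.
  exact: fintype.subset_trans (fintype.subset_trans D2D1 D1D) DA.
move=> p q pD2 qD2.
have pD1 := fintype.subsetP D2D1 p pD2; have qD1 := fintype.subsetP D2D1 q qD2.
have b_pq := clb p q pD1 qD1; have c_pq := clc p q pD2 qD2.
split; [|exact: le_trans b_pq r8|exact: le_trans c_pq r8].
have := slab p (fintype.subsetP D1D p pD1).
have := slab q (fintype.subsetP D1D q qD1).
move=> /ler_normlP[q1 q2] /ler_normlP[p1 p2].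
have u10 : 0 < `|u1| by exact: lt_le_trans cu1.
have hb : `|u2 * (fb p - fb q)| <= `|u1| * r by rewrite normrM ler_pM.
have hc : `|u3 * (fc p - fc q)| <= `|u1| * r by rewrite normrM ler_pM.
have : `|u1 * (fa p - fa q)| <= 6 * r + 2 * (`|u1| * r).
  move: hb hc => /ler_normlP[h1 h2] /ler_normlP[h3 h4].
  by apply/ler_normlP; split; lra.
rewrite normrM -ler_pdivlMl// mulrDr (mulrCA _ 2) mulKf ?gt_eqF// => h.
apply: le_trans h _.
have iv : `|u1|^-1 <= c^-1 by rewrite lef_pV2.
have : `|u1|^-1 * (6 * r) <= c^-1 * (6 * r) by rewrite ler_wpM2r//; lra.
have : r <= c^-1 * r by rewrite ler_peMl ?invf_ge1// ltW.
lra.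
Qed.

Lemma card_pairs_le (E : {set T * T}) D (B : R) : 0 <= B ->
  (forall e, e \in E -> e.1 \in D) ->
  (forall p, p \in D -> #|[set q | (p, q) \in E]|%:R <= B) ->
  #|E|%:R <= #|D|%:R * B.
Proof.
move=> B0 ED EB; rewrite -sum1_card (partition_big fst (mem D))/=; last exact: ED.
rewrite natr_sum mulr_natl -sumr_const; apply: ler_sum => p pD.
rewrite sum1dep_card; apply: le_trans (EB p pD); rewrite ler_nat.
have sI : {in [set e | (e \in E) && (e.1 == p)] &, injective snd}.
  move=> [p1 q1] [p2 q2]; rewrite !inE/= => /andP[_ /eqP ->] /andP[_ /eqP ->].
  by move=> ->.
rewrite -(card_in_imset sI) subset_leq_card//; apply/fintype.subsetP => q.
by move=> /imsetP[[p1 q1]]; rewrite inE/= => /andP[+ /eqP ep] -> /=; rewrite inE ep.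
Qed.

End counting.

(** * Distribution of cross products *)

Section cross_products.
Variables (R : realType) (T : finType) (fa fb fc : T -> R).
Variables (delta : R) (Psi : R -> R) (A : {set T}).
Hypotheses (fro : frostman fa fb fc delta Psi A).
Hypotheses (a01 : in_unit A fa) (b01 : in_unit A fb) (c01 : in_unit A fc).

Definition crossa p q : R := fb p * fc q - fc p * fb q.
Definition crossb p q : R := fc p * fa q - fa p * fc q.
Definition crossc p q : R := fa p * fb q - fb p * fa q.

(** The cross product has sup norm at least c. *)
Definition cross_ge (c : R) p q :=
  [|| c <= `|crossa p q|, c <= `|crossb p q| | c <= `|crossc p q|].

Let frob : frostman fb fa fc delta Psi A.
Proof. exact: frostman_swap. Qed.

Let froc : frostman fc fa fb delta Psi A.
Proof. exact: frostman_rot. Qed.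

Lemma in_unit_norm (f : T -> R) p : in_unit A f -> p \in A -> `|f p| = f p /\ f p <= 1.
Proof. by move=> f01 /f01/andP[f0 f1]; rewrite ger0_norm. Qed.

(** For fixed p, the points q with a prescribed cross product p x q lie in a
    tube along p; the three cases are the coordinates in which p is large. *)
Lemma cross_tube_count (D : {set T}) p (c r : R) : D \subset A -> p \in A ->
  0 < c <= 1 -> [|| c <= fa p, c <= fb p | c <= fc p] ->
  0 < r <= 1 -> delta <= r ->
  {in D &, forall q q', [/\ `|crossa p q - crossa p q'| <= 2 * r,
     `|crossb p q - crossb p q'| <= 2 * r &
     `|crossc p q - crossc p q'| <= 2 * r]} ->
  #|D|%:R <= 2 / r * Psi (3 * r / c).
Proof.
move=> DA pA c01' cp r01 dr cl.
have [na a1] := in_unit_norm a01 pA; have [nb b1] := in_unit_norm b01 pA.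
have [nc c1] := in_unit_norm c01 pA.
case/or3P: cp => cp.
- apply: (tube_count (x1 := fa p) (x2 := fb p) (x3 := fc p) fro a01) => //;
    rewrite ?na ?nb ?nc// => q q' qD q'D.
  have [_ hb hc] := cl q q' qD q'D; split; [move: hc|move: hb].
    by apply: le_trans; rewrite le_eqVlt; apply/orP; left; apply/eqP;
      congr `|_|; rewrite /crossc; ring.
  by apply: le_trans; rewrite le_eqVlt -normrN; apply/orP; left; apply/eqP;
    congr `|_|; rewrite /crossb; ring.
- apply: (tube_count (x1 := fb p) (x2 := fa p) (x3 := fc p) frob b01) => //;
    rewrite ?na ?nb ?nc// => q q' qD q'D.
  have [ha _ hc] := cl q q' qD q'D; split; [move: hc|move: ha].
    by apply: le_trans; rewrite le_eqVlt -normrN; apply/orP; left; apply/eqP;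
      congr `|_|; rewrite /crossc; ring.
  by apply: le_trans; rewrite le_eqVlt; apply/orP; left; apply/eqP;
    congr `|_|; rewrite /crossa; ring.
- apply: (tube_count (x1 := fc p) (x2 := fa p) (x3 := fb p) froc c01) => //;
    rewrite ?na ?nb ?nc// => q q' qD q'D.
  have [ha hb _] := cl q q' qD q'D; split; [move: hb|move: ha].
    by apply: le_trans; rewrite le_eqVlt; apply/orP; left; apply/eqP;
      congr `|_|; rewrite /crossb; ring.
  by apply: le_trans; rewrite le_eqVlt -normrN; apply/orP; left; apply/eqP;
    congr `|_|; rewrite /crossa; ring.
Qed.

(** The largest coordinate of the normal vector plays the first role in
    [slab_count]. *)
Lemma cross_slab_count (D : {set T}) (u1 u2 u3 c r : R) : D \subset A ->
  0 < c <= 1 -> [|| c <= `|u1|, c <= `|u2| | c <= `|u3|] ->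
  0 < r <= 1 -> delta <= r ->
  {in D, forall p, `|u1 * fa p + u2 * fb p + u3 * fc p| <= 3 * r} ->
  #|D|%:R <= 2 / r * (2 / r * Psi (8 * r / c)).
Proof.
move=> DA c01' cu r01 dr slab.
have main1 : `|u2| <= `|u1| -> `|u3| <= `|u1| ->
    #|D|%:R <= 2 / r * (2 / r * Psi (8 * r / c)).
  move=> u21 u31; apply: (slab_count fro b01 c01 DA c01' _ u21 u31 r01 dr slab).
  by case/or3P: cu => // h; apply: le_trans h _.
have main2 : `|u1| <= `|u2| -> `|u3| <= `|u2| ->
    #|D|%:R <= 2 / r * (2 / r * Psi (8 * r / c)).
  move=> u12 u32; apply: (slab_count frob a01 c01 DA c01' _ u12 u32 r01 dr).
    by case/or3P: cu => // h; apply: le_trans h _.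
  by move=> p pD; rewrite (addrC (u2 * _)); exact: slab.
have main3 : `|u1| <= `|u3| -> `|u2| <= `|u3| ->
    #|D|%:R <= 2 / r * (2 / r * Psi (8 * r / c)).
  move=> u13 u23; apply: (slab_count froc a01 b01 DA c01' _ u13 u23 r01 dr).
    by case/or3P: cu => // h; apply: le_trans h _.
  by move=> p pD; rewrite -addrA addrC; exact: slab.
have [u12|u21] := lerP `|u1| `|u2|.
  have [u23|u32] := lerP `|u2| `|u3|; first by apply: main3 (le_trans u12 u23) u23.
  exact: main2 u12 (ltW u32).
have [u13|u31] := lerP `|u1| `|u3|; first by apply: main3 u13 (ltW (lt_le_trans u21 u13)).
exact: main1 (ltW u21) (ltW u31).
Qed.

Lemma cross_ge_coord c p q : p \in A -> q \in A -> cross_ge c p q ->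
  [|| c <= fa p, c <= fb p | c <= fc p].
Proof.
move=> pA qA.
have /andP[ap0 ap1] := a01 pA; have /andP[bp0 bp1] := b01 pA.
have /andP[cp0 cp1] := c01 pA.
have /andP[aq0 aq1] := a01 qA; have /andP[bq0 bq1] := b01 qA.
have /andP[cq0 cq1] := c01 qA.
have aux (x y u v : R) : 0 <= x -> 0 <= y -> 0 <= u <= 1 -> 0 <= v <= 1 ->
    c <= `|x * u - y * v| -> (c <= x) || (c <= y).
  move=> x0 y0 /andP[u0 u1] /andP[v0 v1].
  have h1 : 0 <= x * u <= x by rewrite mulr_ge0//= ler_piMr.
  have h2 : 0 <= y * v <= y by rewrite mulr_ge0//= ler_piMr.
  case: (ger0P (x * u - y * v)) => [h|h] ch; apply/orP.
    by left; move: h1 h2 => /andP[? ?] /andP[? ?]; lra.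
  by right; move: h1 h2 => /andP[? ?] /andP[? ?]; lra.
case/or3P => h.
- have /orP[->|->] : (c <= fb p) || (c <= fc p) by apply: aux h; rewrite ?bq0 ?cq0.
    by rewrite orbT.
  by rewrite !orbT.
- have /orP[->|->] : (c <= fc p) || (c <= fa p) by apply: aux h; rewrite ?aq0 ?cq0.
    by rewrite !orbT.
  by [].
- have /orP[->|->] : (c <= fa p) || (c <= fb p) by apply: aux h; rewrite ?aq0 ?bq0.
    by [].
  by rewrite orbT.
Qed.

(** If p x q is r-close to u then p . u = p . (u - p x q) is O(r), so p lies in
    a slab; since |p x q| >= c, the vector u is bounded below as well. *)
Lemma cross_count (E : {set T * T}) (u1 u2 u3 c r : R) :
  (forall p q, (p, q) \in E -> [/\ p \in A, q \in A & cross_ge c p q]) ->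
  (forall p q, (p, q) \in E -> [/\ `|crossa p q - u1| <= r,
     `|crossb p q - u2| <= r & `|crossc p q - u3| <= r]) ->
  0 < c <= 1 -> 0 < r -> r <= c / 2 -> delta <= r ->
  0 <= Psi (3 * r / c) -> 0 <= Psi (8 * r / (c / 2)) ->
  #|E|%:R <= 2 / r * (2 / r * Psi (8 * r / (c / 2))) * (2 / r * Psi (3 * r / c)).
Proof.
move=> EA Eu /andP[c0 c1] r0 rc dr P3 P8.
have r2 : 0 <= 2 / r by rewrite divr_ge0// ltW.
have r01 : 0 < r <= 1 by apply/andP; split => //; lra.
pose D := [set p | [exists q, (p, q) \in E]].
have Dsub : D \subset A.
  by apply/fintype.subsetP => p; rewrite inE => /existsP[q /EA[]].
apply: le_trans (card_pairs_le (D := D) (B := 2 / r * Psi (3 * r / c)) _ _ _) _.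
- by rewrite mulr_ge0.
- by move=> [p q] pqE; rewrite inE; apply/existsP; exists q.
- move=> p; rewrite inE => /existsP[q0 pq0].
  have [pA q0A cge] := EA _ _ pq0.
  apply: (@cross_tube_count _ p c r) => //.
  + by apply/fintype.subsetP => q; rewrite inE => /EA[].
  + by rewrite c0.
  + exact: cross_ge_coord cge.
  + move=> q q'; rewrite !inE => /Eu[ha hb hc] /Eu[ha' hb' hc'].
    have tri (x y z : R) : `|x - z| <= r -> `|y - z| <= r -> `|x - y| <= 2 * r.
      move=> /ler_normlP[? ?] /ler_normlP[? ?].
      by apply/ler_normlP; split; lra.
    by split; [exact: tri ha ha'|exact: tri hb hb'|exact: tri hc hc'].
apply: ler_wpM2r; first by rewrite mulr_ge0.
have [->|/set0Pn[p0 p0D]] := eqVneq D finset.set0.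
  by rewrite cards0; apply: mulr_ge0 => //; apply: mulr_ge0.
have half : 0 < c / 2 <= 1 by apply/andP; split; lra.
apply: (cross_slab_count (u1 := u1) (u2 := u2) (u3 := u3)) => //.
  move: p0D; rewrite inE => /existsP[q0 pq0].
  have [_ _ cge] := EA _ _ pq0; have [ha hb hc] := Eu _ _ pq0.
  have tri (x y : R) : c <= `|x| -> `|x - y| <= r -> c / 2 <= `|y|.
    by move=> cx xy; have := ler_normD (x - y) y; rewrite subrK; lra.
  case/or3P: cge => cge.
  - by rewrite (tri _ _ cge ha).
  - by rewrite (tri _ _ cge hb) orbT.
  - by rewrite (tri _ _ cge hc) !orbT.
move=> p; rewrite inE => /existsP[q pq].
have [pA _ _] := EA _ _ pq; have [ha hb hc] := Eu _ _ pq.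
have [na a1] := in_unit_norm a01 pA; have [nb b1] := in_unit_norm b01 pA.
have [nc c1'] := in_unit_norm c01 pA.
(* p is orthogonal to its cross product with q *)
have -> : u1 * fa p + u2 * fb p + u3 * fc p =
   - ((crossa p q - u1) * fa p + (crossb p q - u2) * fb p + (crossc p q - u3) * fc p).
  by rewrite /crossa /crossb /crossc; ring.
have bd (x y : R) : `|x| <= r -> `|y| <= 1 -> `|x * y| <= r.
  by move=> xr y1; rewrite normrM -[leRHS]mulr1 ler_pM.
rewrite normrN (le_trans (ler_normD _ _))//.
have := ler_normD ((crossa p q - u1) * fa p) ((crossb p q - u2) * fb p).
have := bd _ (fa p) ha; have := bd _ (fb p) hb; have := bd _ (fc p) hc.
rewrite na nb nc => /(_ c1') h1 /(_ b1) h2 /(_ a1) h3; lra.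
Qed.

(** Either p is in the cluster around the origin, or the cross product is
    small because q is in a thin tube along p. *)
Lemma degenerate_pairs_count (c d : R) :
  0 < c <= 1 -> delta <= c -> 0 < d <= 1 -> delta <= d ->
  0 <= Psi c -> 0 <= Psi (3 * d / c) ->
  #|[set e : T * T | [&& e.1 \in A, e.2 \in A & ~~ cross_ge d e.1 e.2]]|%:R <=
  #|A|%:R * (Psi c + 2 / d * Psi (3 * d / c)).
Proof.
move=> c01' dc d01 dd Pc Pd.
have /andP[d0 d1] := d01.
pose A1 := [set p in A | [&& fa p < c, fb p < c & fc p < c]].
pose E1 := [set e : T * T | (e.1 \in A1) && (e.2 \in A)].
pose E2 := [set e : T * T | [&& e.1 \in A :\: A1, e.2 \in A &
  ~~ cross_ge d e.1 e.2]].
apply: (@le_trans _ _ (#|E1|%:R + #|E2|%:R)).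
  rewrite -natrD ler_nat (leq_trans _ (leq_card_setU _ _))//.
  apply: subset_leq_card; apply/fintype.subsetP => -[p q].
  rewrite !inE/= => /and3P[pA qA ->]; rewrite pA qA /=.
  by case: (fa p < c); case: (fb p < c); case: (fc p < c).
rewrite mulrDr lerD//.
  rewrite mulrC; apply: le_trans (card_pairs_le (D := A1) (B := #|A|%:R) _ _ _) _.
  - by [].
  - by move=> e; rewrite inE => /andP[].
  - move=> p _; rewrite ler_nat subset_leq_card//; apply/fintype.subsetP => q.
    by rewrite !inE => /andP[].
  apply: ler_wpM2r => //; apply: (fro dc).
    by apply/fintype.subsetP => p; rewrite inE => /andP[].
  have cl (x y : R) : 0 <= x <= 1 -> 0 <= y <= 1 -> x < c -> y < c -> `|x - y| <= c.
    move=> /andP[? ?] /andP[? ?] ? ?; apply/ler_normlP; split; lra.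
  move=> p q; rewrite !inE => /andP[pA /and3P[? ? ?]] /andP[qA /and3P[? ? ?]].
  by split; apply: cl => //; [exact: a01|exact: a01|exact: b01|exact: b01
    |exact: c01|exact: c01].
have B0 : 0 <= 2 / d * Psi (3 * d / c) by rewrite mulr_ge0// divr_ge0// ltW.
apply: le_trans (card_pairs_le (D := A) B0 _ _) _ => //.
  by move=> e; rewrite !inE => /and3P[/andP[]].
move=> p pA; have [pA1|pA1] := boolP (p \in A1).
  rewrite (_ : [set q | _] = finset.set0) ?cards0//.
  by apply/setP => q; rewrite !inE/=; move: pA1; rewrite inE => ->.
apply: (@cross_tube_count _ p c d) => //.
- by apply/fintype.subsetP => q; rewrite !inE => /and3P[].
- by move: pA1; rewrite inE pA/= !negb_and -!leNgt.
- have tri (x y : R) : `|x| < d -> `|y| < d -> `|x - y| <= 2 * d.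
    move=> /ltr_normlP[? ?] /ltr_normlP[? ?].
    by apply/ler_normlP; split; lra.
  move=> q q'; rewrite !inE/= => /and3P[_ _ h1] /and3P[_ _ h2].
  move: h1 h2; rewrite /cross_ge !negb_or -!ltNge.
  by move=> /and3P[? ? ?] /and3P[? ? ?]; split; apply: tri.
Qed.

End cross_products.

(** * Points of bounded potential *)

Section potential.
Variables (R : realType) (T : finType) (fa fb fc : T -> R).
Variables (dist : T -> T -> R) (delta C : R).
Hypotheses (delta0 : 0 < delta) (C0 : 0 < C).
Hypothesis dist_ge : forall p q,
  [/\ `|fa p - fa q| <= dist p q, `|fb p - fb q| <= dist p q &
      `|fc p - fc q| <= dist p q].
Hypothesis dist_le : forall p q,
  dist p q <= `|fa p - fa q| + `|fb p - fb q| + `|fc p - fc q|.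
Hypothesis unit_coords : forall p,
  [/\ 0 <= fa p <= 1, 0 <= fb p <= 1 & 0 <= fc p <= 1].

Let n : R := #|T|%:R.

Definition potential p : R := \sum_q (dist p q + 2 * delta) `^ (- (13 / 5)).

Definition regular_points := [set p | potential p <= 2 * C * n].

Definition gauge (rho : R) : R := 2 * C * n * (5 * rho) `^ (13 / 5).

Let A := regular_points.

Lemma dist_ge0 p q : 0 <= dist p q.
Proof. by have [/(le_trans (normr_ge0 _))] := dist_ge p q. Qed.

Let gap p q : 0 < dist p q + 2 * delta.
Proof. by move: (dist_ge0 p q) (delta0) => h1 h2; lra. Qed.

Lemma gauge_ge0 rho : 0 <= gauge rho.
Proof. by rewrite !mulr_ge0 ?powR_ge0// ltW. Qed.

(** Markov's inequality. *)
Lemma card_regular_points : \sum_p potential p <= C * n ^+ 2 -> n <= 2 * #|A|%:R.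
Proof.
move=> pot.
have h : 2 * C * n * #|~: A|%:R <= C * n ^+ 2.
  apply: le_trans pot; rewrite mulr_natr -sumr_const.
  rewrite [leRHS](bigID (mem A))/=.
  apply: le_trans (_ : \sum_(i | i \notin A) potential i <= _); last first.
    by rewrite lerDr; apply: sumr_ge0 => p _; apply: sumr_ge0 => q _; exact: powR_ge0.
  rewrite (eq_bigl (fun i => i \notin A)); last by move=> p; rewrite inE.
  apply: ler_sum => p; rewrite inE -ltNge => /ltW//.
have cA : #|A|%:R + #|~: A|%:R = n :> R by rewrite -natrD cardsC.
have [n0|n0] := eqVneq n 0; first by rewrite n0 mulr_ge0.
have n0' : 0 < n by rewrite lt_def n0 /n ler0n.
have : 2 * #|~: A|%:R <= n.
  rewrite -(ler_pM2l (mulr_gt0 C0 n0')); move: h; rewrite expr2; lra.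
lra.
Qed.

(** A cluster around a point contributes to its potential at least its
    cardinality times (5 rho)^(-13/5). *)
Lemma regular_frostman : frostman fa fb fc delta gauge A.
Proof.
move=> rho D dr DA cl; have r0 : 0 < rho by exact: lt_le_trans dr.
have [->|/set0Pn[p pD]] := eqVneq D finset.set0.
  by rewrite cards0 gauge_ge0.
have pA : potential p <= 2 * C * n.
  by have := fintype.subsetP DA p pD; rewrite inE.
have r5 : 0 < 5 * rho by rewrite mulr_gt0.
have s0 : 0 < (5 * rho) `^ (13 / 5) by rewrite powR_gt0.
rewrite /gauge -ler_pdivrMr//; apply: le_trans pA.
rewrite mulrC mulr_natr -sumr_const /potential [leRHS](bigID (mem D))/=.
apply: le_trans (_ : \sum_(q in D) (dist p q + 2 * delta) `^ (- (13 / 5)) <= _);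
  last by rewrite lerDl; apply: sumr_ge0 => q _; exact: powR_ge0.
apply: ler_sum => q qD; rewrite powRN lef_pV2 ?posrE ?powR_gt0//.
have s13 : 0 <= 13 / 5 :> R by lra.
apply: ge0_ler_powR; rewrite ?nnegrE ?(ltW (gap _ _)) ?mulr_ge0 ?(ltW r0)//.
by have [? ? ?] := cl p q pD qD; have := dist_le p q; lra.
Qed.

(** Distances are bounded, so the inverse square is dominated by the power
    -13/5. *)
Lemma inverse_square_sum p : p \in A ->
  \sum_q ((dist p q + 2 * delta) ^+ 2)^-1 <= (3 + 2 * delta) * (2 * C * n).
Proof.
have d0 := delta0; rewrite inE => pA; apply: (@le_trans _ _ ((3 + 2 * delta) * potential p)); last first.
  by rewrite ler_wpM2l//; lra.
rewrite /potential mulr_sumr; apply: ler_sum => q _.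
set x := dist p q + 2 * delta; have x0 : 0 < x := gap p q.
have x3 : x <= 3 + 2 * delta.
  rewrite /x lerD2r (le_trans (dist_le p q))//.
  have d1 (u v : R) : 0 <= u <= 1 -> 0 <= v <= 1 -> `|u - v| <= 1.
    by move=> /andP[? ?] /andP[? ?]; apply/ler_normlP; split; lra.
  have [a1 b1 c1] := unit_coords p; have [a2 b2 c2] := unit_coords q.
  by have := d1 _ _ a1 a2; have := d1 _ _ b1 b2; have := d1 _ _ c1 c2; lra.
rewrite powRN ler_pdivlMr ?powR_gt0//.
rewrite ler_pdivrMl ?exprn_gt0// -powR_mulrn ?(ltW x0)//.
have x1 : x `^ (13 / 5) = x `^ 2%:R * x `^ (3 / 5).
  rewrite -powRD; last by rewrite (gt_eqF x0) implybT.
  by congr (_ `^ _); field.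
rewrite x1 ler_wpM2l ?powR_ge0//.
have D1 : 1 <= 3 + 2 * delta by lra.
have D0 : 0 <= 3 + 2 * delta by lra.
apply: (@le_trans _ _ ((3 + 2 * delta) `^ (3 / 5))).
  by apply: ge0_ler_powR; rewrite ?nnegrE ?(ltW x0)//; lra.
by rewrite -[leRHS]powRr1//; apply: ler_powR => //; lra.
Qed.

(** Bounding one factor by its decay and the two others by J^2, for each
    coordinate, gives decay in the Euclidean distance; at distances below
    delta the trivial bound J^6 is as good because J h delta is bounded. *)
Lemma fejer3_bound J (h : R) p q : 0 <= h <= 1 -> J%:R * h * delta <= 8 ->
  fejer J (h * (fa p - fa q)) * fejer J (h * (fb p - fb q)) *
  fejer J (h * (fc p - fc q)) * (h ^+ 2 * (dist p q + 2 * delta) ^+ 2) <=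
  1088 * J%:R ^+ 4.
Proof.
have d0 := delta0; move=> /andP[h0 h1] Jh.
set ea := fejer J (h * (fa p - fa q)); set eb := fejer J (h * (fb p - fb q)).
set ec := fejer J (h * (fc p - fc q)); set J2 : R := J%:R ^+ 2.
have d1 (u v : R) : 0 <= u <= 1 -> 0 <= v <= 1 -> `|h * (u - v)| <= 1.
  move=> /andP[? ?] /andP[? ?]; rewrite normrM ger0_norm//.
  rewrite -[leRHS]mulr1 ler_pM//; apply/ler_normlP; split; lra.
have [a1 b1 c1] := unit_coords p; have [a2 b2 c2] := unit_coords q.
have Da := fejer_decay J (d1 _ _ a1 a2); have Db := fejer_decay J (d1 _ _ b1 b2).
have Dc := fejer_decay J (d1 _ _ c1 c2).
have ea0 : 0 <= ea by exact: fejer_ge0. have eb0 : 0 <= eb by exact: fejer_ge0.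
have ec0 : 0 <= ec by exact: fejer_ge0.
have eaJ : ea <= J2 by exact: fejer_le. have ebJ : eb <= J2 by exact: fejer_le.
have ecJ : ec <= J2 by exact: fejer_le.
have J20 : 0 <= J2 by exact: sqr_ge0.
move: Da Db Dc; rewrite -/ea -/eb -/ec.
set ta := h * (fa p - fa q); set tb := h * (fb p - fb q).
set tc := h * (fc p - fc q) => Da Db Dc.
have J4 : J%:R ^+ 4 = J2 * J2 :> R by rewrite /J2; ring.
have m3 (x y z : R) : 0 <= x -> 0 <= y -> 0 <= z -> x <= 32 -> y <= J2 -> z <= J2 ->
    x * y * z <= 32 * (J2 * J2).
  by move=> x0 y0 z0 xX yY zZ; rewrite -mulrA ler_pM ?mulr_ge0// ler_pM.
have Pa : ea * eb * ec * ta ^+ 2 <= 32 * (J2 * J2).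
  have -> : ea * eb * ec * ta ^+ 2 = (ta ^+ 2 * ea) * eb * ec by ring.
  by apply: m3 => //; rewrite mulr_ge0// sqr_ge0.
have Pb : ea * eb * ec * tb ^+ 2 <= 32 * (J2 * J2).
  have -> : ea * eb * ec * tb ^+ 2 = (tb ^+ 2 * eb) * ea * ec by ring.
  by apply: m3 => //; rewrite mulr_ge0// sqr_ge0.
have Pc : ea * eb * ec * tc ^+ 2 <= 32 * (J2 * J2).
  have -> : ea * eb * ec * tc ^+ 2 = (tc ^+ 2 * ec) * ea * eb by ring.
  by apply: m3 => //; rewrite mulr_ge0// sqr_ge0.
have P0 : ea * eb * ec * (h * delta) ^+ 2 <= 64 * (J2 * J2).
  have e3 : ea * eb * ec <= J2 * J2 * J2 by rewrite ler_pM ?mulr_ge0// ler_pM.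
  apply: le_trans (ler_wpM2r (sqr_ge0 _) e3) _.
  have Jh2 : (J%:R * h * delta) ^+ 2 <= 64.
    rewrite (_ : 64 = 8 ^+ 2); last by ring.
    by rewrite ler_sqr ?nnegrE// !mulr_ge0// ltW.
  have -> : J2 * J2 * J2 * (h * delta) ^+ 2 = (J%:R * h * delta) ^+ 2 * (J2 * J2).
    by rewrite /J2; ring.
  by rewrite ler_wpM2r// mulr_ge0.
have dd : dist p q ^+ 2 * h ^+ 2 <= 3 * (ta ^+ 2 + tb ^+ 2 + tc ^+ 2).
  have : (h * dist p q) ^+ 2 <= (`|ta| + `|tb| + `|tc|) ^+ 2.
    rewrite ler_sqr ?nnegrE ?addr_ge0//; last by rewrite mulr_ge0// dist_ge0.
    rewrite !normrM (ger0_norm h0) -!mulrDr ler_wpM2l//.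
  rewrite -[ta ^+ 2]real_normK ?num_real// -[tb ^+ 2]real_normK ?num_real//.
  rewrite -[tc ^+ 2]real_normK ?num_real//.
  have := sqr_ge0 (`|ta| - `|tb|); have := sqr_ge0 (`|ta| - `|tc|).
  have := sqr_ge0 (`|tb| - `|tc|); lra.
have E0 : 0 <= ea * eb * ec by rewrite !mulr_ge0.
have := ler_wpM2l E0 dd.
have := mulr_ge0 E0 (sqr_ge0 (h * dist p q - 2 * (h * delta))).
rewrite J4; lra.
Qed.

End potential.

(** * Decay of the exponential sum along cross products *)

Section spectral_decay.
Variables (R : realType) (T : finType) (fa fb fc : T -> R).
Variables (dist : T -> T -> R) (delta C : R).
Hypotheses (delta0 : 0 < delta) (delta1 : delta <= 1) (C0 : 0 < C).
Hypothesis dist_ge : forall p q,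
  [/\ `|fa p - fa q| <= dist p q, `|fb p - fb q| <= dist p q &
      `|fc p - fc q| <= dist p q].
Hypothesis dist_le : forall p q,
  dist p q <= `|fa p - fa q| + `|fb p - fb q| + `|fc p - fc q|.
Hypothesis unit_coords : forall p,
  [/\ 0 <= fa p <= 1, 0 <= fb p <= 1 & 0 <= fc p <= 1].

Let n : R := #|T|%:R.
Let A := regular_points dist delta C.
Let ca := crossa fb fc.
Let cb := crossb fa fc.
Let cc := crossc fa fb.

Variables (c : R) (G : {set T * T}).
Hypothesis c01 : 0 < c <= 1.
Hypothesis GA : forall p q, (p, q) \in G ->
  [/\ p \in A, q \in A & cross_ge fa fb fc c p q].

(** The first summand comes from [cross_count], the second covers radii that
    are not small with respect to c, where the number of all pairs is used. *)
Definition count_constant : R :=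
  4 * C ^+ 2 * (160 / c) `^ (13 / 5) * (30 / c) `^ (13 / 5) + (4 / c) `^ (11 / 5).

Lemma count_constant_ge0 : 0 <= count_constant.
Proof.
rewrite addr_ge0 ?powR_ge0//; apply: mulr_ge0; last exact: powR_ge0.
by apply: mulr_ge0; [rewrite mulr_ge0 ?sqr_ge0|exact: powR_ge0].
Qed.

(** [cross_count] at radius 2 y.  The slab gains y^(3/5) and the tube y^(8/5),
    whence the exponent 11/5. *)
Lemma cross_multiplicity (E : {set T * T}) (u1 u2 u3 y : R) : E \subset G ->
  0 < y -> delta <= y ->
  (forall p q, (p, q) \in E -> [/\ `|ca p q - u1| <= 2 * y,
     `|cb p q - u2| <= 2 * y & `|cc p q - u3| <= 2 * y]) ->
  #|E|%:R <= count_constant * n ^+ 2 * y `^ (11 / 5).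
Proof.
have C1 := C0; have d0 := delta0.
move=> EG y0 dy Eu; have /andP[c0 c1] := c01.
have n2 : 0 <= n ^+ 2 by exact: sqr_ge0.
(* Large radius: y is bounded below, and all pairs may be counted. *)
have [yc|yc] := lerP (2 * y) (c / 2); last first.
  apply: le_trans (_ : (4 / c) `^ (11 / 5) * n ^+ 2 * y `^ (11 / 5) <= _).
    rewrite mulrAC -powRM ?divr_ge0 ?(ltW c0) ?(ltW y0)//.
    apply: le_trans (_ : n ^+ 2 <= _).
      rewrite /n -natrX ler_nat (leq_trans (max_card _))// card_prod.
      by rewrite expnS expn1.
    rewrite ler_peMl//; have : 1 <= 4 / c * y.
      by rewrite mulrAC ler_pdivlMr//; lra.
    move=> h1; rewrite -[leLHS](powRr0 (4 / c * y)) ler_powR//.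
  rewrite ler_wpM2r ?powR_ge0// ler_wpM2r// /count_constant lerDr.
  by do 2!(apply: mulr_ge0; last exact: powR_ge0); rewrite mulr_ge0 ?sqr_ge0.
apply: le_trans (_ : 4 * C ^+ 2 * (160 / c) `^ (13 / 5) * (30 / c) `^ (13 / 5) *
   n ^+ 2 * y `^ (11 / 5) <= _); last first.
  by rewrite ler_wpM2r ?powR_ge0// ler_wpM2r// /count_constant lerDl powR_ge0.
have fro : frostman fa fb fc delta (gauge T C) A by exact: regular_frostman.
have ua : in_unit A fa by move=> p _; case: (unit_coords p).
have ub : in_unit A fb by move=> p _; case: (unit_coords p).
have uc : in_unit A fc by move=> p _; case: (unit_coords p).
have y20 : 0 < 2 * y by lra.
have dy2 : delta <= 2 * y by lra.
apply: le_trans (cross_count fro ua ub uc (c := c) _ Eu c01 y20 yc dy2 _ _) _.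
- by move=> p q pqE; apply: GA; exact: fintype.subsetP EG _ pqE.
- exact: gauge_ge0.
- exact: gauge_ge0.
rewrite /gauge -/n.
have -> : 5 * (8 * (2 * y) / (c / 2)) = (160 / c) * y by field; rewrite gt_eqF.
have -> : 5 * (3 * (2 * y) / c) = (30 / c) * y by field; rewrite gt_eqF.
have ci : 0 <= c^-1 by rewrite invr_ge0 ltW.
have y0' := ltW y0.
rewrite !powRM ?mulr_ge0//.
have -> : y `^ (11 / 5) = y `^ (13 / 5) * y `^ (13 / 5) * (y^-1) ^+ 3.
  rewrite exprVn -powR_mulrn ?(ltW y0)// -powRN.
  rewrite -!powRD ?(gt_eqF y0) ?implybT//; congr (_ `^ _); lra.
rewrite le_eqVlt; apply/orP; left; apply/eqP; field.
by rewrite gt_eqF.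
Qed.

(** Rounding to (1/N) Z, shifted by 1 so as to stay in nat on [-1, 1]. *)
Definition lattice_round (N : nat) (x : R) : nat := Num.truncn (N%:R * (x + 1)).

Lemma lattice_roundP N x : (0 < N)%N -> -1 <= x <= 1 ->
  (lattice_round N x <= N.*2)%N /\
  `|x - (N%:R^-1 * (lattice_round N x)%:R - 1)| <= N%:R^-1.
Proof.
move=> N0 /andP[x1 x2]; have N0' : 0 < N%:R :> R by rewrite ltr0n.
have h0 : 0 <= N%:R * (x + 1) by rewrite mulr_ge0//; lra.
have /andP[l1 l2] := truncn_itv h0; split.
  have := le_lt_trans l1; rewrite /lattice_round truncn_le_nat => _.
  rewrite -natr1 -mul2n natrM.
  have : N%:R * (x + 1) <= N%:R * 2 by rewrite ler_wpM2l//; lra.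
  lra.
move: l1 l2; rewrite -/(lattice_round N x) -natr1 => l1 l2.
have k1 : N%:R^-1 * (lattice_round N x)%:R <= x + 1 by rewrite ler_pdivrMl.
have k2 : x + 1 <= N%:R^-1 * ((lattice_round N x)%:R + 1).
  by rewrite ler_pdivlMl// ltW.
rewrite mulrDr mulr1 in k2; rewrite ler_norml; apply/andP; split; lra.
Qed.

Definition rounded N x : R := N%:R^-1 * (lattice_round N x)%:R - 1.

Lemma cross_itv (x y z w : R) : 0 <= x <= 1 -> 0 <= y <= 1 -> 0 <= z <= 1 ->
  0 <= w <= 1 -> -1 <= x * y - z * w <= 1.
Proof.
move=> /andP[x0 x1] /andP[y0 y1] /andP[z0 z1] /andP[w0 w1].
have : 0 <= x * y <= 1 by rewrite mulr_ge0//= mulr_ile1.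
have : 0 <= z * w <= 1 by rewrite mulr_ge0//= mulr_ile1.
by move=> /andP[? ?] /andP[? ?]; apply/andP; split; lra.
Qed.

Lemma cross_bounds p q :
  [/\ -1 <= ca p q <= 1, -1 <= cb p q <= 1 & -1 <= cc p q <= 1].
Proof.
have [? ? ?] := unit_coords p; have [? ? ?] := unit_coords q.
by split; apply: cross_itv.
Qed.

(** 4 bounds the product of two weights, 1088 comes from [fejer3_bound],
    256 from (3 L + 1)^4 <= 256 L^4, and 540 / 8 from [inverse_square_sum]
    (a factor 10 C) and L N^2 <= 54 t a^3 against the 8 a^3 lattice points of
    the smoothing cube. *)
Definition decay_constant : R := (4 * 1088 * 256 * 540 / 8) * C * count_constant.

Lemma decay_constant_ge0 : 0 <= decay_constant.
Proof.
apply: mulr_ge0; last exact: count_constant_ge0.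
apply: mulr_ge0; last exact: ltW.
apply: mulr_ge0; last by rewrite invr_ge0.
by do 3!(apply: mulr_ge0; last exact: ler0n); exact: ler0n.
Qed.

(** [spectral_bound] with N = 3 a, h = 1 / N and L = N (t + 1): the smoothing
    cube has half-side 1/3, and a cube around a frequency contains t V(p, q),
    V(p, q) the rounded cross product, only if p x q lies in a ball of radius
    2 / t. *)
Lemma spectral_decay (a t : nat) : (0 < a)%N -> (0 < t)%N -> (t <= 3 * a)%N ->
  t%:R * delta <= 1 ->
  \sum_(e in G) sqsum A (fun=> 1) (phase fa fb fc
     (t%:R * rounded (3 * a) (ca e.1 e.2)) (t%:R * rounded (3 * a) (cb e.1 e.2))
     (t%:R * rounded (3 * a) (cc e.1 e.2))) <=
  decay_constant * n ^+ 4 * t%:R^-1 `^ (6 / 5).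
Proof.
have C1 := C0; have d0 := delta0; have d1 := delta1.
move=> a0 t0 tN td; set N := (3 * a)%N; pose L := (N * t.+1)%N.
pose h : R := N%:R^-1; pose y : R := t%:R^-1.
have N0 : (0 < N)%N by rewrite muln_gt0.
have N0' : 0 < N%:R :> R by rewrite ltr0n.
have t0' : 0 < t%:R :> R by rewrite ltr0n.
have a0' : 0 < a%:R :> R by rewrite ltr0n.
have h0 : 0 < h by rewrite invr_gt0.
have y0 : 0 < y by rewrite invr_gt0.
have hN : h * N%:R = 1 by rewrite mulVf// gt_eqF.
have NE : N%:R = 3 * a%:R :> R by rewrite natrM.
have Ndef : N = (3 * a)%N by [].
have hy : h <= y by rewrite lef_pV2 ?posrE// ler_nat.
clearbody N.
have dy : delta <= y by rewrite -[y]mul1r ler_pdivlMr// mulrC.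
have yt : y * t%:R = 1 by rewrite mulVf// gt_eqF.
pose B := count_constant * n ^+ 2 * y `^ (11 / 5).
have B0 : 0 <= B by rewrite !mulr_ge0 ?count_constant_ge0 ?sqr_ge0 ?powR_ge0.
pose k (f : T -> T -> R) (i : 'I_#|G|) : nat :=
  (t * lattice_round N (f (enum_val i).1 (enum_val i).2) + a.*2)%N.
have LE : L%:R = N%:R * t%:R + N%:R :> R.
  by rewrite /L natrM -natr1 mulrDr mulr1.
have kE (f : T -> T -> R) i : h * (k f i + a)%:R - h * L%:R =
    t%:R * rounded N (f (enum_val i).1 (enum_val i).2).
  rewrite /k /rounded -/h; set r := lattice_round _ _.
  rewrite LE !natrD natrM -mul2n natrM.
  have -> : h * (t%:R * r%:R + 2 * a%:R + a%:R) = h * t%:R * r%:R + h * N%:R.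
    by rewrite NE; ring.
  have -> : h * (N%:R * t%:R + N%:R) = h * N%:R * t%:R + h * N%:R by ring.
  by rewrite hN; ring.
have kL (f : T -> T -> R) i : (forall p q, -1 <= f p q <= 1) ->
    (k f i + a.*2 <= L.*2)%N.
  move=> f1; have [r2 _] := lattice_roundP N0 (f1 (enum_val i).1 (enum_val i).2).
  rewrite /k; move: r2; set r := lattice_round _ _ => r2.
  have tr : (t * r <= t * N.*2)%N by rewrite leq_mul2l r2 orbT.
  have -> : L.*2 = (t * N.*2 + N.*2)%N by rewrite /L mulnC doubleMr mulSn addnC.
  rewrite -addnA; apply: leq_add tr _.
  by rewrite {}Ndef -!mul2n -mulnDl mulnA leq_mul2r orbT.
have kB (m1 m2 m3 : nat) : #|[set i | [&& k ca i <= m1 <= k ca i + a.*2,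
    k cb i <= m2 <= k cb i + a.*2 & k cc i <= m3 <= k cc i + a.*2]%N]|%:R <= B.
  set S := [set i | _]; pose u (m : nat) := y * (h * m%:R - h * L%:R).
  rewrite -(card_imset (mem S) enum_val_inj).
  apply: (@cross_multiplicity _ (u m1) (u m2) (u m3) y) => //.
    by apply/fintype.subsetP => e /imsetP[i _ ->]; exact: enum_valP.
  have near (f : T -> T -> R) i m : (forall p q, -1 <= f p q <= 1) ->
      (k f i <= m <= k f i + a.*2)%N ->
      `|f (enum_val i).1 (enum_val i).2 - u m| <= 2 * y.
    move=> f1 /andP[m1' m2'].
    have [_ fr] := lattice_roundP N0 (f1 (enum_val i).1 (enum_val i).2).
    have e1 : rounded N (f (enum_val i).1 (enum_val i).2) =
        y * (h * (k f i + a)%:R - h * L%:R).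
      by rewrite kE mulrA yt mul1r.
    have e2 : `|rounded N (f (enum_val i).1 (enum_val i).2) - u m| <= y.
      rewrite e1 /u -mulrBr normrM (gtr0_norm y0) ler_piMr ?(ltW y0)//.
      rewrite opprB addrA subrK -mulrBr normrM (gtr0_norm h0) mulrC ler_pdivrMr// mul1r.
      have l1 : (k f i)%:R <= m%:R :> R by rewrite ler_nat.
      have l2 : m%:R <= (k f i)%:R + 2 * a%:R :> R.
        by rewrite -natrM -natrD ler_nat mul2n.
      rewrite natrD NE; apply/ler_normlP; split; lra.
    move: fr; rewrite -/(rounded N _) -/h => fr.
    have := ler_normD (f (enum_val i).1 (enum_val i).2 -
      rounded N (f (enum_val i).1 (enum_val i).2))
      (rounded N (f (enum_val i).1 (enum_val i).2) - u m).
    by rewrite addrA subrK; lra.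
  move=> p q /imsetP[i]; rewrite inE => /and3P[i1 i2 i3] epq.
  have -> : p = (enum_val i).1 by rewrite -epq.
  have -> : q = (enum_val i).2 by rewrite -epq.
  by split; apply: near => // p' q'; case: (cross_bounds p' q').
have L0 : (0 < L)%N by rewrite muln_gt0 N0.
have L0' : 0 < L%:R :> R by rewrite ltr0n.
have ha : h * a%:R * 3 <= 1.
  by rewrite -mulrA (mulrC a%:R) -NE hN.
have A1 : {in A, forall p, [/\ 0 <= fa p <= 1, 0 <= fb p <= 1 & 0 <= fc p <= 1]}.
  by move=> p _; exact: unit_coords.
have kL3 i : [/\ k ca i + a.*2 <= L.*2, k cb i + a.*2 <= L.*2 &
    k cc i + a.*2 <= L.*2]%N.
  by split; apply: kL => p q; case: (cross_bounds p q).
have := spectral_bound L0 (ltW h0) ha A1 kL3 kB.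
set J := (3 * L).+1.
set X := \sum_(i < _) _; set Y := \sum_(p in A) _ => XY.
have -> : \sum_(e in G) sqsum A (fun=> 1) (phase fa fb fc
     (t%:R * rounded N (ca e.1 e.2)) (t%:R * rounded N (cb e.1 e.2))
     (t%:R * rounded N (cc e.1 e.2))) = X.
  rewrite big_enum_val; apply: eq_bigr => i _.
  by rewrite !kE.
have JL : J%:R <= 4 * L%:R :> R by rewrite -natrM ler_nat /J (mulSn 3) -add1n leq_add2r.
have J0 : 0 <= J%:R :> R by [].
have J40 : 0 <= J%:R ^+ 4 :> R by exact: exprn_ge0.
have N20 : 0 <= N%:R ^+ 2 :> R by exact: exprn_ge0.
have L40 : 0 <= L%:R ^+ 4 :> R by exact: exprn_ge0.
clearbody J L.
have [K1 K1E K10] : exists2 K1 : R, K1 = 1088 & 0 <= K1.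
  by exists 1088%:R; [reflexivity|exact: ler0n].
have [K2 K2E K20] : exists2 K2 : R, K2 = 256 & 0 <= K2.
  by exists 256%:R; [reflexivity|exact: ler0n].
have Cn0 : 0 <= 10 * C * n by rewrite mulr_ge0// mulr_ge0// ltW.
have Cn20 : 0 <= 10 * C * n ^+ 2.
  by apply: mulr_ge0; [rewrite mulr_ge0// ltW|exact: sqr_ge0].
have KJN : 0 <= K1 * J%:R ^+ 4 * N%:R ^+ 2 by do 2!apply: mulr_ge0 => //.
have B40 : 0 <= 4 * B by exact: mulr_ge0.
have X0 : 0 <= X by apply: sumr_ge0 => i _; exact: sqsum_ge0.
have hL : h * L%:R = t%:R + 1.
  by rewrite LE mulrDr mulrA hN mul1r.
have t1 : 1 <= t%:R :> R by rewrite ler1n.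
have Jhd : J%:R * h * delta <= 8.
  have : J%:R * h <= 4 * (t%:R + 1).
    by rewrite -hL (mulrCA 4) (mulrC J%:R); apply: ler_wpM2l => //; exact: ltW.
  move=> /(ler_wpM2r (ltW d0)) /le_trans; apply; nra.
have h1 : 0 <= h <= 1.
  by rewrite (ltW h0)/= invf_le1// ler1n.
(* The sum of the kernels, by decay in each term and the potential. *)
have YB : Y <= K1 * J%:R ^+ 4 * N%:R ^+ 2 * (10 * C * n ^+ 2).
  apply: (@le_trans _ _ (\sum_(p in A) \sum_q
      K1 * J%:R ^+ 4 * N%:R ^+ 2 * ((dist p q + 2 * delta) ^+ 2)^-1)).
    apply: ler_sum => p pA; rewrite [leRHS](bigID (mem A))/=.
    rewrite -[leLHS]addr0; apply: lerD; last first.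
      by apply: sumr_ge0 => q _; rewrite mulr_ge0// invr_ge0 sqr_ge0.
    apply: ler_sum => q qA.
    have g0 : 0 < dist p q + 2 * delta by have := dist_ge0 dist_ge p q; lra.
    rewrite ler_pdivlMr ?exprn_gt0//.
    have := fejer3_bound d0 dist_ge dist_le unit_coords p q h1 Jhd.
    rewrite -/J; set ff := (_ * _ * fejer _ _) => fb1; rewrite -K1E in fb1.
    have -> : ff * (dist p q + 2 * delta) ^+ 2 =
        ff * (h ^+ 2 * (dist p q + 2 * delta) ^+ 2) * N%:R ^+ 2.
      have -> : ff * (h ^+ 2 * (dist p q + 2 * delta) ^+ 2) * N%:R ^+ 2 =
        ff * (dist p q + 2 * delta) ^+ 2 * (h * N%:R) ^+ 2 by ring.
      by rewrite hN expr1n mulr1.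
    by rewrite ler_wpM2r// sqr_ge0.
  apply: (@le_trans _ _ (\sum_(p in A)
      K1 * J%:R ^+ 4 * N%:R ^+ 2 * (10 * C * n))).
    apply: ler_sum => p pA; rewrite -mulr_sumr ler_wpM2l//.
    apply: le_trans (inverse_square_sum d0 dist_ge dist_le unit_coords pA) _.
    rewrite -/n (_ : 10 * C * n = 5 * (2 * C * n)); last by ring.
    by rewrite ler_wpM2r ?mulr_ge0 ?(ltW C1)//; lra.
  rewrite sumr_const -[leLHS]mulr_natl.
  have -> : K1 * J%:R ^+ 4 * N%:R ^+ 2 * (10 * C * n ^+ 2) =
     n * (K1 * J%:R ^+ 4 * N%:R ^+ 2 * (10 * C * n)) by ring.
  apply: ler_wpM2r; first exact: mulr_ge0.
  by rewrite /n ler_nat max_card.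
have J4 : J%:R ^+ 4 <= K2 * L%:R ^+ 4 :> R.
  have -> : K2 * L%:R ^+ 4 = (4 * L%:R) ^+ 4 :> R by rewrite K2E; ring.
  by rewrite lerXn2r// nnegrE.
have n2 : 0 <= n ^+ 2 by exact: sqr_ge0.
have XB1 : a.*2.+1%:R ^+ 3 * L%:R ^+ 3 * X <=
    4 * B * (K1 * (K2 * L%:R ^+ 4) * N%:R ^+ 2 * (10 * C * n ^+ 2)).
  apply: le_trans XY _; apply: ler_wpM2l => //; apply: le_trans YB _.
  by do 2!apply: ler_wpM2r => //; apply: ler_wpM2l.
have XB2 : 8 * a%:R ^+ 3 * X <=
    4 * B * (K1 * K2 * L%:R * N%:R ^+ 2 * (10 * C * n ^+ 2)).
  rewrite -(ler_pM2l (exprn_gt0 3 L0')).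
  apply: (@le_trans _ _ (a.*2.+1%:R ^+ 3 * L%:R ^+ 3 * X)).
    rewrite mulrA (mulrC (L%:R ^+ 3)); apply: ler_wpM2r => //.
    apply: ler_wpM2r; first exact: exprn_ge0.
    rewrite (_ : 8 * a%:R ^+ 3 = (2 * a%:R) ^+ 3); last by ring.
    have a20 : 0 <= 2 * a%:R :> R by exact: mulr_ge0.
    by rewrite lerXn2r ?nnegrE// -natrM ler_nat mul2n.
  by apply: le_trans XB1 _; rewrite le_eqVlt; apply/orP; left; apply/eqP; field.
have L2 : L%:R <= 6 * t%:R * a%:R :> R.
  have := ler_wpM2r (ltW a0') t1; rewrite LE NE; lra.
have XB3 : 8 * a%:R ^+ 3 * X <=
    4 * B * (K1 * K2 * (6 * t%:R * a%:R) * N%:R ^+ 2 * (10 * C * n ^+ 2)).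
  apply: le_trans XB2 _; apply: ler_wpM2l => //.
  do 2!apply: ler_wpM2r => //; apply: ler_wpM2l => //; exact: mulr_ge0.
have XB4 : X <= (4 * 1088 * 256 * 540 / 8) * C * n ^+ 2 * B * t%:R.
  have a30 : 0 < 8 * a%:R ^+ 3 :> R by apply: mulr_gt0 => //; exact: exprn_gt0.
  rewrite -(ler_pM2l a30); apply: le_trans XB3 _.
  by rewrite NE K1E K2E le_eqVlt; apply/orP; left; apply/eqP; field.
apply: le_trans XB4 _; rewrite /B /decay_constant -/y.
have -> : y `^ (11 / 5) = y `^ (6 / 5) * y.
  rewrite -[X in _ = _ * X](powRr1 (ltW y0)) -powRD ?(gt_eqF y0) ?implybT//.
  by congr (_ `^ _); lra.
rewrite le_eqVlt; apply/orP; left; apply/eqP.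
transitivity ((4 * 1088 * 256 * 540 / 8) * C * n ^+ 2 * (count_constant * n ^+ 2 * y `^ (6 / 5)) * (y * t%:R)).
  by ring.
by rewrite yt; ring.
Qed.

End spectral_decay.

(** * Summation over the frequencies of a Fejer kernel *)

Section averaging.
Variable R : realType.

(** By induction the partial sums are at most 6 - 5 m^(-1/5).  With
    x = m^(-1/5) and y = (m + 1)^(-1/5) the step is y^6 <= 5 (x - y), which
    follows from x^5 - y^5 = x^5 y^5. *)
Lemma sum_inv_powR_le m : \sum_(k < m) (k.+1%:R^-1 : R) `^ (6 / 5) <= 6.
Proof.
pose b (k : nat) : R := k.+1%:R^-1 `^ 5^-1.
have b0 k : 0 < b k by rewrite powR_gt0// invr_gt0 ltr0n.
have b5 k : b k ^+ 5 = k.+1%:R^-1.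
  rewrite -powR_mulrn ?(ltW (b0 k))// /b -powRrM mulVf// powRr1// invr_ge0 ler0n//.
have b6 k : (k.+1%:R^-1 : R) `^ (6 / 5) = b k ^+ 6.
  rewrite -powR_mulrn ?(ltW (b0 k))// /b -powRrM; congr (_ `^ _); lra.
case: m => [|m]; first by rewrite big_ord0.
suff H : \sum_(k < m.+1) (k.+1%:R^-1 : R) `^ (6 / 5) <= 6 - 5 * b m.
  by apply: le_trans H _; have := b0 m; lra.
elim: m => [|m IH].
  rewrite big_ord_recr big_ord0/= add0r b6.
  have -> : b 0%N = 1 by rewrite /b invr1 powR1.
  by rewrite expr1n; lra.
rewrite big_ord_recr/= b6; apply: le_trans (lerD IH (lexx _)) _.
have := b5 m; have := b5 m.+1; have := b0 m; have := b0 m.+1.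
set x := b m; set y := b m.+1 => y0 x0 y5 x5.
have yx : y <= x.
  rewrite /x /y /b; apply: ge0_ler_powR; rewrite ?nnegrE ?invr_ge0 ?ler0n//.
  by rewrite lef_pV2 ?posrE ?ltr0n// ler_nat.
have m0 : m.+1%:R != 0 :> R by rewrite pnatr_eq0.
have m1 : m.+2%:R != 0 :> R by rewrite pnatr_eq0.
have xy5 : x ^+ 5 - y ^+ 5 = x ^+ 5 * y ^+ 5.
  rewrite x5 y5; move: m0 m1; rewrite -[m.+2%:R]natr1.
  by move: (m.+1%:R : R) => u m0 m1; field; rewrite m0 m1.
have x4 : 0 < x ^+ 4 by rewrite exprn_gt0.
have key : y ^+ 6 <= 5 * (x - y).
  apply: (@le_trans _ _ (x * y ^+ 5)).
    by rewrite exprS ler_wpM2r// exprn_ge0// ltW.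
  rewrite -(ler_pM2l x4).
  have -> : x ^+ 4 * (x * y ^+ 5) = x ^+ 5 * y ^+ 5 by ring.
  rewrite -xy5.
  have -> : x ^+ 5 - y ^+ 5 =
    (x - y) * (x ^+ 4 + x ^+ 3 * y + x ^+ 2 * y ^+ 2 + x * y ^+ 3 + y ^+ 4) by ring.
  have -> : x ^+ 4 * (5 * (x - y)) = (x - y) * (5 * x ^+ 4) by ring.
  apply: ler_wpM2l; first by rewrite subr_ge0.
  have le4 i j : x ^+ i * y ^+ j <= x ^+ (i + j).
    rewrite exprD ler_wpM2l ?exprn_ge0 ?(ltW x0)//.
    by rewrite lerXn2r ?nnegrE ?(ltW x0) ?(ltW y0).
  have := le4 3 1; have := le4 2 2; have := le4 1 3; have := le4 0 4.
  by rewrite !expr1 expr0 mul1r; lra.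
lra.
Qed.

(** The differences j - k equal to 0 number M; every other absolute value t is
    taken at most 2 M times. *)
Lemma dsum_even_le M (S : R -> R) (s0 s1 : R) : (forall x, S (- x) = S x) ->
  0 <= s1 -> S 0 <= s0 ->
  (forall t : nat, (0 < t < M)%N -> S t%:R <= s1 * t%:R^-1 `^ (6 / 5)) ->
  dsum M S <= M%:R * (s0 + 12 * s1).
Proof.
move=> Sev s10 S0 St.
suff H m : (m <= M)%N -> dsum m S <= m%:R * (s0 + 12 * s1) by exact: H.
elim: m => [_|m IH mM]; first by rewrite /dsum big_ord0 mul0r.
have row : \sum_(k < m) S (m%:R - k%:R) <= 6 * s1.
  rewrite (reindex_inj rev_ord_inj)/=.
  apply: (@le_trans _ _ (s1 * \sum_(k < m) (k.+1%:R^-1 : R) `^ (6 / 5))).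
    rewrite mulr_sumr; apply: ler_sum => k _.
    rewrite -natrB ?leq_subr// subKn//; apply: St.
    by rewrite /= (leq_ltn_trans (ltn_ord k) mM).
  rewrite mulrC; apply: ler_wpM2r => //; exact: sum_inv_powR_le.
have -> : dsum m.+1 S = dsum m S + 2 * \sum_(k < m) S (m%:R - k%:R) + S 0.
  rewrite /dsum big_ord_recr/= big_ord_recr/= subrr.
  under eq_bigr do rewrite big_ord_recr/=.
  rewrite big_split/=.
  have -> : \sum_(i < m) S (i%:R - m%:R) = \sum_(i < m) S (m%:R - i%:R).
    by apply: eq_bigr => i _; rewrite -Sev opprB.
  by ring.
rewrite -natr1 mulrDl mul1r; have := IH (ltnW mM); lra.
Qed.

(** All the cosines in the kernel are at least 1/2. *)
Lemma fejer_ge M (b e : R) : `|b| <= e -> M%:R * e <= 1 -> M%:R ^+ 2 / 4 <= fejer M b.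
Proof.
move=> be Me; rewrite /fejer.
have e0 : 0 <= e by exact: le_trans be.
have : M%:R / 2 <= \sum_(j < M) cos (j%:R * b).
  rewrite -[in leLHS](card_ord M) mulrC mulr_natr -sumr_const; apply: ler_sum => j _.
  apply: cos_ge_half; rewrite normrM ger0_norm//.
  apply: le_trans Me; apply: ler_pM => //; rewrite ler_nat; exact/ltnW.
move=> h.
have : (M%:R / 2) ^+ 2 <= (\sum_(j < M) cos (j%:R * b)) ^+ 2.
  by rewrite lerXn2r ?nnegrE ?(le_trans _ h)// divr_ge0.
have := sqr_ge0 (\sum_(j < M) sin (j%:R * b)); lra.
Qed.

End averaging.

(** * Coincidences between volumes, averaged over pairs *)

Section coincidences.
Variables (R : realType) (T : finType) (fa fb fc : T -> R).
Variables (dist : T -> T -> R) (delta C : R).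
Hypotheses (delta0 : 0 < delta) (delta1 : delta <= 1 / 5) (C0 : 0 < C).
Hypothesis dist_ge : forall p q,
  [/\ `|fa p - fa q| <= dist p q, `|fb p - fb q| <= dist p q &
      `|fc p - fc q| <= dist p q].
Hypothesis dist_le : forall p q,
  dist p q <= `|fa p - fa q| + `|fb p - fb q| + `|fc p - fc q|.
Hypothesis unit_coords : forall p,
  [/\ 0 <= fa p <= 1, 0 <= fb p <= 1 & 0 <= fc p <= 1].

Let n : R := #|T|%:R.
Let A := regular_points dist delta C.
Let ca := crossa fb fc.
Let cb := crossb fa fc.
Let cc := crossc fa fb.

Variables (c : R) (G : {set T * T}).
Hypothesis c01 : 0 < c <= 1.
Hypothesis GA : forall p q, (p, q) \in G ->
  [/\ p \in A, q \in A & cross_ge fa fb fc c p q].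

(** The determinant with columns p, q, z, as (p x q) . z. *)
Definition det3 p q z : R :=
  crossa fb fc p q * fa z + crossb fa fc p q * fb z + crossc fa fb p q * fc z.

Definition coincidences (B : {set T}) p q :=
  [set w : T * T | [&& w.1 \in B, w.2 \in B &
     `|det3 p q w.1 - det3 p q w.2| <= 2 * delta]].

(** 40 delta bounds 4 / M, and 12 is twice the bound of [sum_inv_powR_le]. *)
Definition coincidence_constant : R := 40 * (1 + 12 * decay_constant C c).

Lemma sqsumN (B : {set T}) (w phi : T -> R) : sqsum B w (fun p => - phi p) = sqsum B w phi.
Proof.
rewrite !sqsumE; apply: eq_bigr => p _; apply: eq_bigr => q _.
by rewrite -cosN; congr (_ * cos _); ring.
Qed.

(** The kernel has M ~ 1 / (5 delta) terms because rounding the cross product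
    to (1/N) Z^3, 1 / N <= delta, moves (p x q) . (z - z') by at most 3 delta. *)
Lemma coincidences_sum :
  \sum_(e in G) #|coincidences A e.1 e.2|%:R <=
  coincidence_constant * n ^+ 4 * delta.
Proof.
have C1 := C0; have d0 := delta0; have d1 := delta1.
have di0 : 0 <= delta^-1 by rewrite invr_ge0 ltW.
have d5 : 0 < 5 * delta by rewrite mulr_gt0.
have di5 : 0 <= (5 * delta)^-1 by rewrite invr_ge0 ltW.
pose a := (Num.truncn delta^-1).+1; pose M := Num.truncn (5 * delta)^-1.
have /andP[_ aD] := truncn_itv di0.
have /andP[M1 M2] := truncn_itv di5.
have M0 : (0 < M)%N by rewrite /M truncn_gt0 invf_ge1//; lra.
have M0' : 0 < M%:R :> R by rewrite ltr0n.
have Md : M%:R * (5 * delta) <= 1 by rewrite -ler_pdivlMr// div1r.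
have Mge : (M%:R)^-1 <= 10 * delta.
  move: M2; rewrite -/M -[M.+1%:R]natr1 => M2.
  have M11 : 1 <= M%:R :> R by rewrite ler1n.
  rewrite -[leLHS]mul1r ler_pdivrMr//.
  have : 1 <= (M%:R + 1) * (5 * delta).
    by rewrite -ler_pdivrMr// div1r ltW.
  have := ler_wpM2r (ltW d0) M11; lra.
pose N := (3 * a)%N.
have ha : N%:R^-1 <= delta.
  rewrite -[delta]invrK lef_pV2 ?posrE ?invr_gt0// ?ltr0n//.
  apply: le_trans (ltW aD) _; rewrite ler_nat /N /a leq_pmull//.
pose va (e : T * T) : R := rounded N (ca e.1 e.2); pose vb (e : T * T) : R := rounded N (cb e.1 e.2).
pose vc (e : T * T) : R := rounded N (cc e.1 e.2).
pose S (x : R) := \sum_(e in G) sqsum A (fun=> 1)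
  (phase fa fb fc (x * va e) (x * vb e) (x * vc e)).
have n4 : 0 <= n ^+ 4 by rewrite exprn_ge0// ler0n.
have K0 : 0 <= decay_constant C c.
  exact: decay_constant_ge0.
have SM : dsum M S <= M%:R * (n ^+ 4 + 12 * (decay_constant C c * n ^+ 4)).
  apply: dsum_even_le.
  - move=> x; apply: eq_bigr => e _; rewrite -sqsumN; congr sqsum.
    by apply: funext => p; rewrite /phase; ring.
  - by rewrite mulr_ge0.
  - apply: (@le_trans _ _ (\sum_(e in G) n ^+ 2)).
      apply: ler_sum => e _; rewrite /sqsum.
      under eq_bigr do rewrite /phase !mul0r !addr0 cos0 mul1r.
      under [X in _ + X ^+ 2]eq_bigr do rewrite /phase !mul0r !addr0 sin0 mulr0.
      rewrite big1_eq expr0n addr0 sumr_const lerXn2r ?nnegrE ?ler0n//.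
      by rewrite /n ler_nat max_card.
    rewrite sumr_const -[leLHS]mulr_natl (_ : n ^+ 4 = n ^+ 2 * n ^+ 2); last by ring.
    rewrite ler_wpM2r ?sqr_ge0// /n -natrX ler_nat (leq_trans (max_card _))//.
    by rewrite card_prod expnS expn1.
  - move=> t /andP[t0 tM].
    have tM' : t%:R <= M%:R :> R by rewrite ler_nat ltnW.
    apply: spectral_decay => //; first by lra.
    + rewrite -(ler_nat R) natrM.
      have : delta^-1 <= a%:R by exact: ltW.
      have : (5 * delta)^-1 <= delta^-1 by rewrite lef_pV2 ?posrE//; lra.
      lra.
    + have := ler_wpM2r (ltW d5) tM'; lra.
have fejM e : #|coincidences A e.1 e.2|%:R <=
    4 / M%:R ^+ 2 * \sum_(z in A) \sum_(z' in A)
      fejer M (phase fa fb fc (va e) (vb e) (vc e) z -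
               phase fa fb fc (va e) (vb e) (vc e) z').
  rewrite -sum1_card natr_sum mulr_sumr.
  apply: (@le_trans _ _ (\sum_(w : T * T | (w.1 \in A) && (w.2 \in A))
    4 / M%:R ^+ 2 * fejer M (phase fa fb fc (va e) (vb e) (vc e) w.1 -
               phase fa fb fc (va e) (vb e) (vc e) w.2))); last first.
    rewrite -(pair_big (mem A) (mem A) (fun z z' => 4 / M%:R ^+ 2 *
      fejer M (phase fa fb fc (va e) (vb e) (vc e) z -
               phase fa fb fc (va e) (vb e) (vc e) z')))/=.
    by under eq_bigr do rewrite -mulr_sumr.
  rewrite [leRHS](bigID (fun w => w \in coincidences A e.1 e.2))/=.
  rewrite -[leLHS]addr0; apply: lerD; last first.
    apply: sumr_ge0 => w _; rewrite mulr_ge0 ?fejer_ge0// divr_ge0// exprn_ge0//.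
  rewrite [leRHS](eq_bigl (mem (coincidences A e.1 e.2))); last first.
    by move=> w; apply: andb_idl; rewrite inE => /and3P[-> ->].
  apply: ler_sum => w; rewrite inE => /and3P[_ _ wd].
  have -> : (1%N%:R : R) = 4 / M%:R ^+ 2 * (M%:R ^+ 2 / 4).
    by field; rewrite gt_eqF.
  apply: ler_wpM2l; first by rewrite divr_ge0// exprn_ge0.
  apply: (fejer_ge (e := 5 * delta)) => //.
  have [Ba Bb Bc] := cross_bounds unit_coords e.1 e.2.
  have [_ Ra] := lattice_roundP (erefl : (0 < N)%N) Ba.
  have [_ Rb] := lattice_roundP (erefl : (0 < N)%N) Bb.
  have [_ Rc] := lattice_roundP (erefl : (0 < N)%N) Bc.
  have du (x y : R) : 0 <= x <= 1 -> 0 <= y <= 1 -> `|x - y| <= 1.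
    by move=> /andP[? ?] /andP[? ?]; apply/ler_normlP; split; lra.
  have pr (x y u v : R) : `|x - y| <= N%:R^-1 -> `|u - v| <= 1 ->
      `|(x - y) * (u - v)| <= delta.
    by move=> xy uv; rewrite normrM -[leRHS]mulr1 ler_pM// (le_trans xy).
  have [wa1 wb1 wc1] := unit_coords w.1; have [wa2 wb2 wc2] := unit_coords w.2.
  have := pr _ _ _ _ Ra (du _ _ wa1 wa2); have := pr _ _ _ _ Rb (du _ _ wb1 wb2).
  have := pr _ _ _ _ Rc (du _ _ wc1 wc2).
  move: wd; rewrite /det3 /phase /va /vb /vc /rounded /ca /cb /cc.
  move=> /ler_normlP[w1 w2] /ler_normlP[h1 h2] /ler_normlP[h3 h4] /ler_normlP[h5 h6].
  apply/ler_normlP; split; lra.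
have sumE : \sum_(e in G) (\sum_(z in A) \sum_(z' in A)
      fejer M (phase fa fb fc (va e) (vb e) (vc e) z -
               phase fa fb fc (va e) (vb e) (vc e) z')) = dsum M S.
  rewrite /S dsum_sum; apply: eq_bigr => e _.
  have -> : (fun x => sqsum A (fun=> 1) (phase fa fb fc (x * va e) (x * vb e) (x * vc e))) =
    fun x => \sum_(z in A) \sum_(z' in A) cos (0 + x *
      (phase fa fb fc (va e) (vb e) (vc e) z - phase fa fb fc (va e) (vb e) (vc e) z')).
    apply: funext => x; rewrite sqsumE; apply: eq_bigr => z _; apply: eq_bigr => z' _.
    by rewrite mulr1 mul1r; congr cos; rewrite /phase; ring.
  rewrite dsum_sum; apply: eq_bigr => z _; rewrite dsum_sum; apply: eq_bigr => z' _.
  by rewrite dsum_cos cos0 mul1r.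
apply: (@le_trans _ _ (4 / M%:R ^+ 2 * dsum M S)).
  by rewrite -sumE mulr_sumr; apply: ler_sum => e _; exact: fejM.
have M2' : 0 <= 4 / M%:R ^+ 2 :> R by rewrite divr_ge0// exprn_ge0.
apply: le_trans (ler_wpM2l M2' SM) _.
have -> : 4 / M%:R ^+ 2 * (M%:R * (n ^+ 4 + 12 * (decay_constant C c * n ^+ 4))) =
   M%:R^-1 * (4 * ((1 + 12 * decay_constant C c) * n ^+ 4)).
  by field; rewrite gt_eqF.
have P0 : 0 <= 4 * ((1 + 12 * decay_constant C c) * n ^+ 4).
  by rewrite mulr_ge0// mulr_ge0// addr_ge0// mulr_ge0.
apply: le_trans (ler_wpM2r P0 Mge) _.
by rewrite /coincidence_constant le_eqVlt; apply/orP; left; apply/eqP; ring.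
Qed.

End coincidences.

(** * A pair of points with few coincidences *)

Lemma card_pairs_split (T : finType) (A : {set T}) (P : rel T) :
  (#|[set e : T * T | [&& e.1 \in A, e.2 \in A & P e.1 e.2]]| +
   #|[set e : T * T | [&& e.1 \in A, e.2 \in A & ~~ P e.1 e.2]]| = #|A| ^ 2)%N.
Proof.
rewrite expnS expn1 -cardsX -[RHS](cardsID [set e : T * T | P e.1 e.2]).
by congr (_ + _)%N; apply: eq_card => -[p q]; rewrite !inE/=; case: (P p q);
  case: (p \in A); case: (q \in A).
Qed.

Section few_coincidences.
Variables (R : realType) (C : R).
Hypothesis C0 : 0 < C.

(** Below this size of p, resp. of p x q, the two terms of
    [degenerate_pairs_count] are at most n / 8 each. *)
Definition coord_scale : R := Num.min (1 / 5) (1 / (80 * C)).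

Definition cross_scale : R :=
  Num.min (coord_scale / 15) (coord_scale ^+ 2 / (80 * 90 * C)).

Lemma coord_scale_bounds :
  [/\ 0 < coord_scale, coord_scale <= 1 / 5 & 80 * C * coord_scale <= 1].
Proof.
have C1 := C0; have C80 : 0 < 80 * C by rewrite mulr_gt0.
split; first by rewrite lt_min !divr_gt0.
- by rewrite ge_min lexx.
- by rewrite mulrC -ler_pdivlMr// ge_min lexx orbT.
Qed.

Lemma cross_scale_bounds : [/\ 0 < cross_scale, 15 * cross_scale <= coord_scale,
  80 * 90 * C * cross_scale <= coord_scale ^+ 2 & cross_scale <= 1 / 75].
Proof.
have [c0 c5 _] := coord_scale_bounds.
have C72 : 0 < 80 * 90 * C by rewrite !mulr_gt0.
have d15 : 15 * cross_scale <= coord_scale.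
  by rewrite mulrC -ler_pdivlMr// ge_min lexx.
split => //.
- by rewrite lt_min !divr_gt0// exprn_gt0.
- by rewrite mulrC -ler_pdivlMr// ge_min lexx orbT.
- lra.
Qed.

Definition few_constant : R := 8 * (coincidence_constant C cross_scale + 1).

Lemma few_constant_gt0 : 0 < few_constant.
Proof.
have [d0 _ _ d75] := cross_scale_bounds.
have d01 : 0 < cross_scale <= 1 by apply/andP; split => //; lra.
rewrite /few_constant mulr_gt0// ltr_wpDl// mulr_ge0// addr_ge0// mulr_ge0//.
exact: decay_constant_ge0.
Qed.

(** At least n^2 / 8 pairs are nondegenerate, so some pair is not worse than
    the average given by [coincidences_sum]. *)
Lemma few_coincidences (T : finType) (fa fb fc : T -> R) (dist : T -> T -> R)
    (delta : R) :
  0 < delta -> delta <= cross_scale ->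
  (forall p q, [/\ `|fa p - fa q| <= dist p q, `|fb p - fb q| <= dist p q &
      `|fc p - fc q| <= dist p q]) ->
  (forall p q,
    dist p q <= `|fa p - fa q| + `|fb p - fb q| + `|fc p - fc q|) ->
  (forall p, [/\ 0 <= fa p <= 1, 0 <= fb p <= 1 & 0 <= fc p <= 1]) ->
  (0 < #|T|)%N ->
  \sum_p potential dist delta p <= C * #|T|%:R ^+ 2 ->
  exists p q (A : {set T}), #|T|%:R <= 2 * #|A|%:R :> R /\
    #|coincidences fa fb fc delta A p q|%:R <= few_constant * #|T|%:R ^+ 2 * delta.
Proof.
move=> d0 dd dist_ge dist_le unit_coords T0 pot; have C1 := C0.
have [c0 c5 c80] := coord_scale_bounds.
have [e0 e15 e72 e75] := cross_scale_bounds.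
set n : R := #|T|%:R; have n0 : 0 < n by rewrite ltr0n.
pose A := regular_points dist delta C.
have nA : n <= 2 * #|A|%:R by exact: card_regular_points pot.
have fro : frostman fa fb fc delta (gauge T C) A by exact: regular_frostman.
have ua : in_unit A fa by move=> p _; case: (unit_coords p).
have ub : in_unit A fb by move=> p _; case: (unit_coords p).
have uc : in_unit A fc by move=> p _; case: (unit_coords p).
have c01 : 0 < coord_scale <= 1 by apply/andP; split => //; lra.
have e01 : 0 < cross_scale <= 1 by apply/andP; split => //; lra.
have dc : delta <= coord_scale by lra.
have g0 rho : 0 <= gauge T C rho by exact: gauge_ge0.
have bad := degenerate_pairs_count fro ua ub uc c01 dc e01 dd (g0 _) (g0 _).
have g1 : gauge T C coord_scale <= n / 8.
  rewrite /gauge -/n.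
  have h : (5 * coord_scale) `^ (13 / 5) <= 5 * coord_scale.
    by apply: ge1r_powR; [apply/andP; split|]; lra.
  have Cn : 0 <= 2 * C * n by rewrite !mulr_ge0 ?(ltW C1) ?(ltW n0).
  apply: le_trans (ler_wpM2l Cn h) _.
  have := ler_wpM2r (ltW n0) c80; lra.
have g2 : 2 / cross_scale * gauge T C (3 * cross_scale / coord_scale) <= n / 8.
  rewrite /gauge -/n; set y := 5 * (3 * cross_scale / coord_scale).
  have yE : y = 15 * cross_scale / coord_scale by rewrite /y; field; rewrite gt_eqF.
  have y0 : 0 < y by rewrite yE divr_gt0// mulr_gt0.
  have y1 : y <= 1 by rewrite yE ler_pdivrMr// mul1r.
  have h : y `^ (13 / 5) <= y ^+ 2.
    have -> : y `^ (13 / 5) = (y ^+ 2) `^ (13 / 10).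
      by rewrite -powR_mulrn ?(ltW y0)// -powRrM; congr (_ `^ _); field.
    apply: ge1r_powR; last by lra.
    by rewrite exprn_gt0// exprn_ile1// ltW.
  have Cn : 0 <= 2 / cross_scale * (2 * C * n).
    by rewrite !mulr_ge0 ?invr_ge0 ?(ltW C1) ?(ltW n0) ?(ltW e0).
  rewrite mulrA; apply: le_trans (ler_wpM2l Cn h) _.
  have -> : 2 / cross_scale * (2 * C * n) * y ^+ 2 =
      80 * 90 * C * cross_scale / coord_scale ^+ 2 * (n / 8).
    by rewrite yE; field; rewrite !gt_eqF.
  rewrite ler_piMl ?divr_ge0 ?(ltW n0)// ler_pdivrMr ?mul1r//.
  by rewrite exprn_gt0.
pose bset := [set e : T * T | [&& e.1 \in A, e.2 \in A &
  ~~ cross_ge fa fb fc cross_scale e.1 e.2]].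
pose G := [set e : T * T | [&& e.1 \in A, e.2 \in A &
  cross_ge fa fb fc cross_scale e.1 e.2]].
have Gb : #|A|%:R ^+ 2 = #|G|%:R + #|bset|%:R :> R.
  by rewrite -natrX -natrD (card_pairs_split A (cross_ge fa fb fc cross_scale)).
have Gn : n ^+ 2 / 8 <= #|G|%:R.
  have bb : #|bset|%:R <= #|A|%:R ^+ 2 / 2 :> R.
    apply: le_trans bad _.
    apply: le_trans (ler_wpM2l (ler0n R #|A|) (lerD g1 g2)) _.
    have := ler_wpM2l (ler0n R #|A|) nA; rewrite expr2; lra.
  have : n ^+ 2 <= (2 * #|A|%:R) ^+ 2.
    by rewrite lerXn2r ?nnegrE ?(ltW n0)// mulr_ge0.
  rewrite exprMn; lra.
have GA p q : (p, q) \in G ->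
    [/\ p \in A, q \in A & cross_ge fa fb fc cross_scale p q].
  by rewrite inE => /and3P[].
have d15 : delta <= 1 / 5 by lra.
have S := coincidences_sum d0 d15 C0 dist_ge dist_le unit_coords e01 GA.
suff [e eG he] : exists2 e, e \in G & #|coincidences fa fb fc delta A e.1 e.2|%:R <=
    few_constant * n ^+ 2 * delta by exists e.1, e.2, A.
apply: contrapT => H.
have H' e : e \in G -> few_constant * n ^+ 2 * delta <=
    #|coincidences fa fb fc delta A e.1 e.2|%:R.
  by move=> eG; case: lerP => // /ltW le; case: H; exists e.
have := le_trans (ler_sum _ H') S.
rewrite sumr_const -[X in X <= _ -> _]mulr_natl -/n.
have k0 := few_constant_gt0; have n2 : 0 < n ^+ 2 by rewrite exprn_gt0.
have kn : 0 <= few_constant * n ^+ 2 * delta.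
  apply: mulr_ge0; last exact: ltW.
  by apply: mulr_ge0; exact: ltW.
move=> /(le_trans (ler_wpM2r kn Gn)).
have -> : n ^+ 2 / 8 * (few_constant * n ^+ 2 * delta) =
    coincidence_constant C cross_scale * n ^+ 4 * delta + n ^+ 4 * delta.
  by rewrite /few_constant; field.
by rewrite gerDl leNgt mulr_gt0// exprn_gt0.
Qed.

End few_coincidences.

(** * From coincidences to separated values *)

Section separated_values.
Local Open Scope fset_scope.
Variable R : realType.

(** Cauchy-Schwarz for the cardinalities of the fibres of g. *)
Lemma sqr_card_le_fibers (T J : finType) (A : {set T}) (g : T -> J) :
  (#|A| ^ 2 <= #|J| * #|[set w : T * T | [&& w.1 \in A, w.2 \in A & g w.1 == g w.2]]|)%N.
Proof.
rewrite -(ler_nat R) natrX natrM.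
pose N j := #|[set z in A | g z == j]|.
have -> : #|A|%:R = \sum_j (N j)%:R :> R.
  rewrite -natr_sum -sum1_card (partition_big g xpredT)//=; congr (_%:R).
  by apply: eq_bigr => j _; rewrite sum1dep_card.
have -> : #|[set w : T * T | [&& w.1 \in A, w.2 \in A & g w.1 == g w.2]]|%:R =
    \sum_j (N j)%:R ^+ 2 :> R.
  rewrite -sum1_card (partition_big (fun w => g w.1) xpredT)//= natr_sum.
  apply: eq_bigr => j _; rewrite sum1dep_card -natrX expnS expn1 -cardsX.
  congr (_%:R); apply: eq_card => -[z z']; rewrite !inE/=.
  have [<-|] := eqVneq (g z) j; last by rewrite !andbF.
  by rewrite !andbT [g z' == _]eq_sym; case: (z \in A).
have := sqr_sum_le [set: J] (fun j => (N j)%:R : R).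
rewrite cardsT (eq_bigl xpredT) => [|j]; last by rewrite inE.
by rewrite [X in _ <= _ * X -> _](eq_bigl xpredT) => // j; rewrite inE.
Qed.

(** A separated subset of maximal cardinality: a value at distance at least
    delta from all of it could be added. *)
Lemma maximal_separated (delta : R) (V : {fset R}) : 0 < delta ->
  exists S : {fset R}, (#|` S| <= num_separated delta V)%N /\
    forall v, v \in V -> exists2 s, s \in S & `|v - s| < delta.
Proof.
move=> d0.
pose P k := `[< exists S : {fset R}, [/\ S `<=` V, Defs.separated delta S & #|` S| = k] >].
have P0 : exists k, P k.
  exists 0%N; apply/asboolP; exists fset0; split=> //; exact: fsub0set.
have Pmax k : P k -> (k <= #|` V|)%N.
  by move=> /asboolP[S [SV _ <-]]; exact: fsubset_leq_card.
case: (ex_maxnP P0 Pmax) => k /asboolP[S [SV sep Sk]] kmax.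
exists S; split.
  rewrite /num_separated.
  rewrite -[leqLHS]/((fun S : {fset R} => #|` S|) S); apply: leq_bigmax_seq.
    by rewrite fpowersetE.
  exact/asboolP.
move=> v vV; apply: contrapT => far.
have far' s : s \in S -> delta <= `|v - s|.
  by move=> sS; rewrite leNgt; apply/negP => vs; apply: far; exists s.
have vS : v \notin S.
  by apply/negP => vS; apply: far; exists v; rewrite // subrr normr0.
have : P k.+1.
  apply/asboolP; exists (v |` S); split.
  - by rewrite fsubUset fsub1set vV.
  - move=> a b; rewrite !inE => /orP[/eqP ->|aS] /orP[/eqP ->|bS].
    + by rewrite eqxx.
    + by move=> _; exact: far'.
    + by move=> _; rewrite distrC; exact: far'.
    + exact: sep.
  - by rewrite cardfsU1 vS Sk.
by move=> /kmax; rewrite ltnn.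
Qed.

(** Send z to a point of a maximal separated set close to f z; points with the
    same image have values within 2 delta. *)
Lemma num_separated_ge (T : finType) (A : {set T}) (f : T -> R) (delta : R)
    (V : {fset R}) : 0 < delta -> (forall z, f z \in V) ->
  (#|A| ^ 2 <= num_separated delta V * #|[set w : T * T |
    [&& w.1 \in A, w.2 \in A & (`|f w.1 - f w.2| <= 2 * delta)%R]]|)%N.
Proof.
move=> d0 fV; have [S [Snum Scov]] := maximal_separated V d0.
have near z : exists s : S, (`|f z - val s| < delta)%R.
  by have [s sS sz] := Scov _ (fV z); exists [` sS].
have [g gP] := boolp.choice near.
apply: leq_trans (sqr_card_le_fibers A g) _.
rewrite -cardfE; apply: leq_mul => //.
apply: subset_leq_card; apply/fintype.subsetP => -[z z'].
rewrite !inE/= => /and3P[-> -> /eqP gzz] /=.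
have /ltr_normlP[h1 h2] := gP z; have /ltr_normlP[h3 h4] := gP z'.
move: h3 h4; rewrite -gzz => h3 h4.
apply/ler_normlP; split; lra.
Qed.

End separated_values.

(** * From the energy integral to a finite sum *)

Section energy_lower_bound.
Local Open Scope classical_set_scope.
Variable R : realType.

(** Monotonicity for a possibly non-measurable g, directly from the definition
    of the integral as a supremum over simple functions; it avoids the
    measurability of the inner energy integral. *)
Lemma ge0_le_integralT d (X : measurableType d) (m : {measure set X -> \bar R})
    (f g : X -> \bar R) : (forall x, 0 <= f x)%E -> (forall x, f x <= g x)%E ->
  (\int[m]_x f x <= \int[m]_x g x)%E.
Proof.
move=> f0 fg; have g0 x : (0 <= g x)%E by exact: le_trans (fg x).
rewrite !ge0_integralTE//; apply: le_ereal_sup => _ [h hf <-].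
by exists h => // x; exact: le_trans (fg x).
Qed.

Lemma edistE (x y : R3 R) : edist x y =
  Num.sqrt ((x.1.1 - y.1.1) ^+ 2 + (x.1.2 - y.1.2) ^+ 2 + (x.2 - y.2) ^+ 2).
Proof. by rewrite /edist !big_ord_recr big_ord0/= add0r. Qed.

Lemma edist_sqr (x y : R3 R) : edist x y ^+ 2 =
  (x.1.1 - y.1.1) ^+ 2 + (x.1.2 - y.1.2) ^+ 2 + (x.2 - y.2) ^+ 2.
Proof. by rewrite edistE sqr_sqrtr// !addr_ge0// sqr_ge0. Qed.

Lemma edist_ge0 (x y : R3 R) : 0 <= edist x y.
Proof. exact: sqrtr_ge0. Qed.

Lemma edistC (x y : R3 R) : edist x y = edist y x.
Proof. by rewrite !edistE; congr Num.sqrt; ring. Qed.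

Lemma edist_triangle (x y z : R3 R) : edist x z <= edist x y + edist y z.
Proof.
rewrite -(@ler_pXn2r _ 2) ?nnegrE ?addr_ge0 ?edist_ge0//.
rewrite sqrrD !edist_sqr.
set a1 := x.1.1 - y.1.1; set a2 := x.1.2 - y.1.2; set a3 := x.2 - y.2.
set b1 := y.1.1 - z.1.1; set b2 := y.1.2 - z.1.2; set b3 := y.2 - z.2.
have -> : x.1.1 - z.1.1 = a1 + b1 :> R by rewrite /a1 /b1; ring.
have -> : x.1.2 - z.1.2 = a2 + b2 :> R by rewrite /a2 /b2; ring.
have -> : x.2 - z.2 = a3 + b3 :> R by rewrite /a3 /b3; ring.
have cs : a1 * b1 + a2 * b2 + a3 * b3 <= edist x y * edist y z.
  have [h|/ltW h] := lerP (a1 * b1 + a2 * b2 + a3 * b3) 0.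
    by apply: le_trans h _; rewrite mulr_ge0 ?edist_ge0.
  rewrite -(@ler_pXn2r _ 2) ?nnegrE ?mulr_ge0 ?edist_ge0//.
  rewrite exprMn !edist_sqr -/a1 -/a2 -/a3 -/b1 -/b2 -/b3.
  have := sqr_ge0 (a1 * b2 - a2 * b1); have := sqr_ge0 (a1 * b3 - a3 * b1).
  have := sqr_ge0 (a2 * b3 - a3 * b2); lra.
move: cs; rewrite mulr2n; lra.
Qed.

Lemma edist_ge_coord (x y : R3 R) : [/\ `|x.1.1 - y.1.1| <= edist x y,
  `|x.1.2 - y.1.2| <= edist x y & `|x.2 - y.2| <= edist x y].
Proof.
have h (t : R) : t ^+ 2 <= edist x y ^+ 2 -> `|t| <= edist x y.
  by rewrite -[t ^+ 2]real_normK ?num_real// ler_sqr ?nnegrE ?edist_ge0.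
have := sqr_ge0 (x.1.1 - y.1.1); have := sqr_ge0 (x.1.2 - y.1.2).
have := sqr_ge0 (x.2 - y.2) => h3 h2 h1.
by split; apply: h; rewrite edist_sqr; lra.
Qed.

Lemma edist_le_coord (x y : R3 R) :
  edist x y <= `|x.1.1 - y.1.1| + `|x.1.2 - y.1.2| + `|x.2 - y.2|.
Proof.
rewrite -(@ler_pXn2r _ 2) ?nnegrE ?addr_ge0 ?edist_ge0//.
rewrite edist_sqr -[X in X + _ + _]real_normK ?num_real//.
rewrite -[X in _ + X + _]real_normK ?num_real// -[X in _ + _ + X]real_normK ?num_real//.
have := mulr_ge0 (normr_ge0 (x.1.1 - y.1.1)) (normr_ge0 (x.1.2 - y.1.2)).
have := mulr_ge0 (normr_ge0 (x.1.1 - y.1.1)) (normr_ge0 (x.2 - y.2)).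
have := mulr_ge0 (normr_ge0 (x.1.2 - y.1.2)) (normr_ge0 (x.2 - y.2)); lra.
Qed.

(** The ball contains the cube with the same centre and side r. *)
Lemma lebesgue3_eball_ge (p : R3 R) (r : R) : 0 < r ->
  ((r ^+ 3)%:E <= @lebesgue3 R (eball p r))%E.
Proof.
move=> r0.
pose I (c : R) : set (measurableTypeR R) := `[c - r / 2, c + r / 2].
have mI c : measurable (I c) by exact: measurable_itv.
have lI c : (@lebesgue_measure R (I c) = r%:E)%E.
  rewrite /I lebesgue_measure_itv/= lte_fin ifT; last by lra.
  by rewrite -EFinD; congr EFin; field.
have -> : (r ^+ 3)%:E = @lebesgue3 R (I p.1.1 `*` I p.1.2 `*` I p.2).
  have e2 : ((@lebesgue_measure R \x @lebesgue_measure R) (I p.1.1 `*` I p.1.2) =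
      r%:E * r%:E)%E by rewrite product_measure1E//; congr (_ * _)%E; exact: lI.
  have -> : (@lebesgue3 R (I p.1.1 `*` I p.1.2 `*` I p.2) =
      (@lebesgue_measure R \x @lebesgue_measure R) (I p.1.1 `*` I p.1.2) *
      @lebesgue_measure R (I p.2))%E.
    by apply: product_measure1E => //; exact: measurableX.
  by rewrite e2 lI -!EFinM; congr EFin; ring.
apply: le_measure; rewrite ?inE.
- by apply: measurableX => //; exact: measurableX.
- exact: measurable_eball.
move=> x [[/= + +] +]; rewrite /I /= !in_itv/= => /andP[a1 a2] /andP[b1 b2] /andP[c1 c2].
rewrite /eball/= -(@ler_pXn2r _ 2) ?nnegrE ?edist_ge0 ?(ltW r0)// edist_sqr.
have h (s t : R) : t - r / 2 <= s -> s <= t + r / 2 -> (t - s) ^+ 2 <= r ^+ 2 / 4.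
  move=> s1 s2; have -> : r ^+ 2 / 4 = (r / 2) ^+ 2 by field.
  rewrite -[(t - s) ^+ 2]real_normK ?num_real// ler_sqr ?nnegrE ?divr_ge0 ?(ltW r0)//.
  by apply/ler_normlP; split; lra.
have := h _ _ a1 a2; have := h _ _ b1 b2; have := h _ _ c1 c2.
have := sqr_ge0 r; lra.
Qed.

Variables (s : R) (P : {fset R3 R}).
Hypothesis s0 : 0 < s.
Hypothesis P0 : (0 < #|` P|)%N.

Let n : R := #|` P|%:R.
Let r : R := n `^ (- s^-1).
Let c : R := n^-1 * n `^ (3 / s).

Let n0 : 0 < n. Proof. by rewrite ltr0n. Qed.
Let r0 : 0 < r. Proof. exact: powR_gt0. Qed.
Let c0 : 0 <= c. Proof. by rewrite mulr_ge0 ?invr_ge0 ?powR_ge0// ltW. Qed.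

Let point (i : nat) : R3 R := nth (0, 0, 0) P i.

Let ball_measurable i : measurable (eball (point i) r).
Proof. exact: measurable_eball. Qed.

Let piece (i : nat) : {measure set R3 R -> \bar R} :=
  mscale (NngNum c0) (mrestr (@lebesgue3 R) (ball_measurable i)).

(** The measure is a finite sum of multiples of Lebesgue measure on balls. *)
Lemma mu_sum_pieces A : measurable A -> mu s P A = msum piece #|` P| A.
Proof.
move=> mA; rewrite /mu /msum.
have dE x : ((mu_density s P x)%:E =
    \sum_(i < #|` P|) (c * \1_(eball (point i) r) x)%:E)%E.
  rewrite /mu_density -/n -/r -/c sumEFin (big_nth (0, 0, 0)) big_mkord mulr_sumr.
  by [].
under eq_integral do rewrite dE.
rewrite ge0_integral_sum//; first last.
- by move=> i x _; rewrite lee_fin mulr_ge0// indicE.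
- move=> i; apply/measurable_EFinP; apply: measurable_funM; first exact: measurable_cst.
  by apply: measurable_indic; exact: ball_measurable.
apply: eq_bigr => i _.
under eq_integral do rewrite EFinM.
have mB : measurable_fun A (fun x => (\1_(eball (point i) r) x : R)%:E).
  by apply/measurable_EFinP/measurable_indic; exact: ball_measurable.
have B0 x : A x -> (0 <= (\1_(eball (point i) r) x : R)%:E)%E.
  by move=> _; rewrite lee_fin indicE.
rewrite ge0_integralZl// integral_indic//= /mscale/= /mrestr.
by rewrite setIC.
Qed.

(** Each ball has mass at least 1 / n, since its volume is at least r^3 and
    c r^3 = 1 / n. *)
Lemma integral_mu_ge (f : R3 R -> \bar R) (a : R3 R -> R) :
  measurable_fun [set: R3 R] f -> (forall x, 0 <= f x)%E ->
  (forall p, 0 <= a p) ->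
  (forall p x, eball p r x -> (a p)%:E <= f x)%E ->
  ((n^-1 * \sum_(p <- P) a p)%:E <= \int[mu s P]_x f x)%E.
Proof.
move=> mf f0 a0 af.
rewrite (eq_measure_integral (msum piece #|` P|)); last first.
  by move=> A mA _; exact: mu_sum_pieces.
rewrite ge0_integral_measure_sum// (big_nth (0, 0, 0)) big_mkord mulr_sumr -sumEFin.
apply: lee_sum => i _.
apply: (@le_trans _ _ (\int[piece i]_(x in eball (point i) r) (a (point i))%:E)%E).
  rewrite integral_cst//= /mscale/= /mrestr setIid.
  apply: (@le_trans _ _ ((a (point i))%:E * (c%:E * (r ^+ 3)%:E))%E); last first.
    by rewrite lee_wpmul2l ?lee_fin// lee_wpmul2l ?lee_fin// lebesgue3_eball_ge.
  rewrite -!EFinM lee_fin /c /r.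
  have -> : n^-1 * n `^ (3 / s) * (n `^ (- s^-1)) ^+ 3 = n^-1.
    rewrite -powR_mulrn ?powR_ge0// -powRrM -mulrA -powRD; last first.
      by rewrite (gt_eqF n0) implybT.
    have -> : 3 / s + - s^-1 * 3%:R = 0 by ring.
    by rewrite powRr0 mulr1.
  by rewrite mulrC.
apply: (@le_trans _ _ (\int[piece i]_(x in eball (point i) r) f x)%E).
  apply: ge0_le_integral => //.
  - by move=> x _; rewrite lee_fin.
  - exact: measurable_funTS.
  - by move=> x; exact: af.
by apply: ge0_subset_integral.
Qed.

Let kernel (x q : R3 R) : R := (edist x q + r) `^ (- s).

Let kernel_ge0 x q : 0 <= kernel x q. Proof. exact: powR_ge0. Qed.

Lemma powRN_anti (x y : R) : 0 < x -> x <= y -> y `^ (- s) <= x `^ (- s).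
Proof.
move=> x0 xy; have y0 : 0 < y by exact: lt_le_trans xy.
rewrite !powRN lef_pV2 ?posrE ?powR_gt0//.
by apply: ge0_ler_powR; rewrite ?nnegrE// ltW.
Qed.

(** The distance is truncated at r to have a finite measurable minorant of the
    kernel; on the ball around q it is at most edist x q + r. *)
Lemma inner_energy_ge x :
  ((n^-1 * \sum_(q <- P) kernel x q)%:E <=
   \int[mu s P]_y ((edist x y `^ s)%:E)^-1)%E.
Proof.
pose trunc y := (Num.max (edist x y) r) `^ (- s).
apply: (@le_trans _ _ (\int[mu s P]_y (trunc y)%:E)%E).
  apply: integral_mu_ge.
  - apply/measurable_EFinP; apply: (measurableT_comp (measurable_powR _)).
    by apply: measurable_maxr; [exact: measurable_edist|exact: measurable_cst].
  - by move=> y; rewrite lee_fin powR_ge0.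
  - by move=> q; exact: kernel_ge0.
  - move=> q y qy; rewrite lee_fin; apply: powRN_anti.
      by rewrite lt_max r0 orbT.
    rewrite ge_max lerDr edist_ge0 andbT.
    by rewrite (le_trans (edist_triangle x q y))// lerD2l.
apply: ge0_le_integralT => y; first by rewrite lee_fin powR_ge0.
rewrite inver; case: eqVneq => [_|e0]; first exact: leey.
have e1 : 0 < edist x y.
  rewrite lt_def edist_ge0 andbT; apply: contra_neq e0 => ->.
  by rewrite powR0// gt_eqF.
by rewrite lee_fin -powRN; apply: powRN_anti => //; rewrite le_max lexx.
Qed.

(** The distance of two points in the balls around p and q is at most
    edist p q + 2 r. *)
Lemma energy_ge (C : R) : adaptable s C P ->
  \sum_(p <- P) \sum_(q <- P) (edist p q + 2 * r) `^ (- s) <= C * n ^+ 2.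
Proof.
rewrite /adaptable /energy => eC.
pose l x := n^-1 * \sum_(q <- P) kernel x q.
have ni0 : 0 <= n^-1 by rewrite invr_ge0 ltW.
have l0 x : 0 <= l x by rewrite mulr_ge0// sumr_ge0.
have lC : (\int[mu s P]_x (l x)%:E <= C%:E)%E.
  apply: le_trans eC; apply: ge0_le_integralT => x; first by rewrite lee_fin.
  exact: inner_energy_ge.
have ml : measurable_fun [set: R3 R] (EFin \o l).
  apply/measurable_EFinP; apply: measurable_funM; first exact: measurable_cst.
  apply: measurable_sum => q; apply: (measurableT_comp (measurable_powR _)).
  apply: measurable_funD; last exact: measurable_cst.
  by under eq_fun do rewrite edistC; exact: measurable_edist.
pose a p := n^-1 * \sum_(q <- P) (edist p q + 2 * r) `^ (- s).
have a0 p : 0 <= a p by rewrite mulr_ge0// sumr_ge0// => q _; exact: powR_ge0.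
have al p x : eball p r x -> ((a p)%:E <= (EFin \o l) x)%E.
  move=> px; rewrite lee_fin /a /l ler_wpM2l// ler_sum// => q _.
  apply: powRN_anti; first by rewrite ltr_wpDl ?edist_ge0.
  have := edist_triangle x p q; rewrite (edistC x p).
  by move: px; rewrite /eball/= => px; lra.
have := le_trans (integral_mu_ge ml (fun x => l0 x) a0 al) lC.
rewrite lee_fin /a -mulr_sumr mulrA -expr2 exprVn ler_pdivrMl ?exprn_gt0//.
by rewrite [C * _]mulrC.
Qed.

End energy_lower_bound.

(** * Volumes *)

Local Open Scope classical_set_scope.
Local Open Scope ring_scope.
Local Open Scope fset_scope.

Lemma volumeE (R : realType) (p q z : R3 R) : (volume p q z =
  (p.1.2 * q.2 - p.2 * q.1.2) * z.1.1 + (p.2 * q.1.1 - p.1.1 * q.2) * z.1.2 +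
  (p.1.1 * q.1.2 - p.1.2 * q.1.1) * z.2)%R.
Proof.
rewrite /volume (expand_det_col _ 2%:R) !big_ord_recr big_ord0/= add0r.
rewrite /cofactor !(expand_det_row _ ord0) !big_ord_recr !big_ord0/= /cofactor.
rewrite !det_mx11 !mxE/= /bump/=.
have -> : ((1 %% 3 + 1 %% 3) %% 3 = 2)%N by [].
rewrite /coord /= /bump /=; ring.
Qed.

Theorem theorem5p2 (R : realType) :
  forall C : R, 0 < C -> forall eps : R, 0 < eps ->
  exists2 Ceps : R, 0 < Ceps &
    forall (n : nat) (P : {fset R3 R}),
      #|` P | = n ->
      (forall p, p \in P -> unit_cube p) ->
      adaptable (13 / 5) C P ->
      n%:R `^ (5 / 13) <=
        Ceps * n%:R `^ eps *
        (num_separated (n%:R `^ (- (5 / 13))) (volumes P))%:R.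
Proof.
move=> C C0 eps eps0.
have [d0 _ _ _] := cross_scale_bounds C0; have K0 := few_constant_gt0 C0.
set d := cross_scale C in d0; set K := few_constant C in K0.
have di0 : (0 < d^-1)%R by rewrite invr_gt0.
exists (4 * K + d^-1)%R; first by rewrite addr_gt0// mulr_gt0.
move=> n P Pn cube ad.
have Ce0 : (0 <= 4 * K + d^-1)%R by rewrite ltW// addr_gt0// mulr_gt0.
have [n0|n0] := posnP n.
  have e5 : (5 / 13 != 0 :> R)%R by rewrite gt_eqF// divr_gt0.
  by rewrite n0 powR0//; do 2!(apply: mulr_ge0 => //); exact: powR_ge0.
have n0' : (0 < n%:R :> R)%R by rewrite ltr0n.
have n1 : (1 <= n%:R :> R)%R by rewrite ler1n.
pose r : R := n%:R `^ (- (5 / 13)).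
have r0 : (0 < r)%R by exact: powR_gt0.
have -> : (n%:R `^ (5 / 13) = r^-1 :> R)%R by rewrite /r powRN invrK.
rewrite -/r.
have cT : #|{: P}| = n by rewrite -Pn cardfE.
pose fa (p : P) : R := (val p).1.1; pose fb (p : P) : R := (val p).1.2.
pose fc (p : P) : R := (val p).2.
pose f (p q z : P) : R := volume (val p) (val q) (val z).
have fV p q z : f p q z \in volumes P.
  by apply/imfsetP; exists (val p, val q, val z) => //=; rewrite !inE/= !fsvalP.
have num (A : {set P}) p q := num_separated_ge A r0 (fV p q).
set N := num_separated r (volumes P) in num *.
have neps : (1 <= n%:R `^ eps :> R)%R by have := ler_powR n1 (ltW eps0); rewrite powRr0.
suff main : (r^-1 <= (4 * K + d^-1) * N%:R)%R.
  by apply: le_trans main _; apply: ler_wpM2r => //; exact: ler_peMr.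
have N1 : (1 <= N%:R :> R)%R.
  have [z _] : exists z : P, true.
    by have := n0; rewrite -cT => /card_gt0P[z _]; exists z.
  rewrite ler1n lt0n; apply/negP => /eqP N0.
  by have := num [set z]%SET z z; rewrite N0 mul0n cards1.
(* For r > d the left side is bounded, and a single value is enough. *)
have [rd|rd] := lerP r d; last first.
  apply: (@le_trans _ _ (d^-1 * N%:R)%R).
    by rewrite -[leLHS]mulr1 ler_pM ?invr_ge0 ?(ltW r0)// lef_pV2 ?posrE// ltW.
  by rewrite ler_wpM2r// lerDr mulr_ge0// ltW.
have pot : (\sum_(p : P) potential (fun p q : P => edist (val p) (val q)) r p <=
    C * #|{: P}|%:R ^+ 2)%R.
  have s0 : (0 < 13 / 5 :> R)%R by rewrite divr_gt0.
  have := energy_ge s0 _ ad; rewrite Pn => /(_ n0).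
  rewrite invf_div -/r cT big_seq_fsetE/= => H; apply: le_trans H.
  by apply: ler_sum => p _; rewrite big_seq_fsetE.
have unit_coords (p : P) : [/\ (0 <= fa p <= 1)%R, (0 <= fb p <= 1)%R & (0 <= fc p <= 1)%R].
  have h := cube _ (fsvalP p); split; [exact: (h 0)|exact: (h 1)|exact: (h 2%:R)].
have T0 : (0 < #|{: P}|)%N by rewrite cT.
have [p [q [A [nA few]]]] := few_coincidences C0 r0 rd
  (fun p q : P => edist_ge_coord (val p) (val q))
  (fun p q : P => edist_le_coord (val p) (val q)) unit_coords T0 pot.
have := num A p q; rewrite -(ler_nat R) natrX natrM.
have -> : [set w : P * P | [&& w.1 \in A, w.2 \in A &
    `|f p q w.1 - f p q w.2| <= 2 * r]]%SET = coincidences fa fb fc r A p q.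
  by apply/setP => w; rewrite !inE /f !volumeE.
move=> /le_trans/(_ (ler_wpM2l (ler0n _ N) few)).
rewrite cT -/K => AN; rewrite cT in nA.
have n2 : (0 < n%:R ^+ 2 :> R)%R by rewrite exprn_gt0.
have h : (n%:R ^+ 2 <= 4 * #|A|%:R ^+ 2 :> R)%R.
  have -> : (4 * #|A|%:R ^+ 2 = (2 * #|A|%:R) ^+ 2 :> R)%R by ring.
  by rewrite lerXn2r ?nnegrE ?mulr_ge0// ltW.
have h2 : (1 <= 4 * K * N%:R * r)%R.
  by rewrite -(ler_pM2l n2); move: AN h; lra.
rewrite -[leLHS]mul1r ler_pdivrMr//; apply: le_trans h2 _.
by rewrite ler_wpM2r ?(ltW r0)// ler_wpM2r// lerDl ltW.
Qed.
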